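(* Let $K\subset\mathbb{R}^2$ be a triangle. Then the infimum $\alpha_1(K)=\inf\{R(K,\Phi_U(K)) : U\subset\mathbb{R}^2\text{ affine subspace},\ \dim U=1\}$ is attained at some $U$, and any $U$ at which it is attained is necessarily (i) parallel to the bisector of one of the largest interior angles of $K$, (ii) parallel to the bisector of one of the smallest interior angles of $K$, or (iii) perpendicular to one of the longest edges of $K$. Moreover, $$\{\alpha_1(K) : K\subset\mathbb{R}^2\text{ is a triangle}\}=\left[1,\sqrt{2}\right),$$ and a triangle $K$ satisfies $\alpha_1(K)=1$ if and only if $K$ is isosceles.
   Context: Triangles are non-degenerate (vertices not collinear). The bisector of an interior angle of a triangle is the one that meets the interior of the triangle. Equilateral triangles count as isosceles. For an affine subspace $U\subset\mathbb{R}^2$, $P_U$ is the orthogonal projection onto $U$ and $\Phi_U(x)=2P_U(x)-x$ is the reflection across $U$. For convex bodies (compact convex sets with nonempty interior) $K,C\subset\mathbb{R}^2$, $R(K,C)=\inf\{\lambda>0 : K\subset z+\lambda C\text{ for some }z\in\mathbb{R}^2\}$. The number $\alpha_1(K)$ is called the first Minkowski chirality of $K$. *)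

(* Defs.v *)
From HB Require Import structures.
From mathcomp Require Import all_boot all_order all_algebra.
From mathcomp Require Import all_classical all_reals all_analysis.
Import Order.TTheory GRing.Theory Num.Theory.
Import numFieldNormedType.Exports.

Set Implicit Arguments.
Unset Strict Implicit.
Unset Printing Implicit Defensive.

Local Open Scope classical_set_scope.
Local Open Scope ring_scope.

(* The norm [`|_|] of ['rV[R]_2] in the library is the sup norm, hence the
   separate Euclidean structure [dot], [enorm].  Its topology is the usual one
   of the plane, so [interior] can be used as is. *)

Section Plane.
Variable R : realType.
Implicit Types (U V K C : set 'rV[R]_2) (x y : 'rV[R]_2) (p : 'I_3 -> 'rV[R]_2).

Definition dot x y : R := \sum_i x 0 i * y 0 i.

Definition enorm x : R := Num.sqrt (dot x x).

Definition affine_subspace (k : nat) U :=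
  exists (a : 'rV[R]_2) (W : {vspace 'rV[R]_2}),
    \dim W = k /\ U = [set x | x - a \in W].

(* For an affine subspace [U] exactly one point satisfies the predicate. *)
Definition orth_proj U x : 'rV[R]_2 :=
  get [set y | U y /\ forall z, U z -> dot (x - y) (z - y) = 0].

Definition reflection U x : 'rV[R]_2 := 2 *: orth_proj U x - x.

(* $R(K,C)$ *)
Definition circumradius K C : R :=
  inf [set lambda : R | 0 < lambda /\
         exists z : 'rV[R]_2, K `<=` [set z + lambda *: c | c in C]].

(* The $j$-th Minkowski chirality $\alpha_j(K)$. *)
Definition chirality (j : nat) K : R :=
  inf [set circumradius K (reflection U @` K) | U in affine_subspace j].

Definition parallel U V := exists z : 'rV[R]_2, V = [set z + x | x in U].

Definition perpendicular U (v : 'rV[R]_2) :=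
  forall x y, U x -> U y -> dot (x - y) v = 0.

Definition collinear p := exists2 U, affine_subspace 1 U & forall i, U (p i).

Definition conv_hull p : set 'rV[R]_2 :=
  [set x | exists t : 'I_3 -> R, [/\ forall i, 0 <= t i,
     \sum_i t i = 1 & x = \sum_i t i *: p i]].

Definition triangle_with_vertices p K := ~ collinear p /\ K = conv_hull p.

Definition is_triangle K := exists p, triangle_with_vertices p K.

(* Arithmetic on the indices ['I_3] of the vertices is modulo 3: edge [i] is the
   one opposite to vertex [i]. *)
Definition edge p (i : 'I_3) : 'rV[R]_2 := p (i + 2) - p (i + 1).

Definition edge_length p i : R := enorm (edge p i).

(* The angle at [o] between the rays from [o] through [x] and [y]. *)
Definition angle (o x y : 'rV[R]_2) : R :=
  acos (dot (x - o) (y - o) / (enorm (x - o) * enorm (y - o))).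

Definition interior_angle p (i : 'I_3) : R :=
  angle (p i) (p (i + 1)) (p (i + 2)).

Definition angle_bisector p (i : 'I_3) U :=
  [/\ affine_subspace 1 U, U (p i) &
      exists x, [/\ U x, interior (conv_hull p) x &
                    angle (p i) x (p (i + 1)) = angle (p i) x (p (i + 2))]].

Definition largest_angle p i := forall j, interior_angle p j <= interior_angle p i.

Definition smallest_angle p i := forall j, interior_angle p i <= interior_angle p j.

Definition longest_edge p i := forall j, edge_length p j <= edge_length p i.

Definition isosceles p :=
  exists i j : 'I_3, i != j /\ edge_length p i = edge_length p j.

End Plane.

(* Main.v *)
Require Import Defs.
From mathcomp Require Import all_boot all_order all_algebra.
From mathcomp Require Import all_classical all_reals all_analysis.
From mathcomp Require Import ring lra.
Import Order.TTheory GRing.Theory Num.Theory.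
Import numFieldNormedType.Exports.

Set Implicit Arguments.
Unset Strict Implicit.
Unset Printing Implicit Defensive.

Local Open Scope classical_set_scope.
Local Open Scope ring_scope.

(** Up to a translation, the reflection across a line is the linear map
    [refl c s] of matrix [[c, s], [s, -c]], with [(c, s)] on the unit circle.
    Writing the sides of the reflected triangle as level sets of barycentric
    coordinates, the smallest homothet containing [K] has ratio
    [sum_i max_j entry i j], whose entries are linear in [(c, s)].  This
    function is positive and piecewise linear, so moving along the tangent of the
    circle and renormalizing strictly decreases it wherever it is locally linear:
    a minimizer must be a tie between two maximal entries of a row.  A tie means
    that one edge is reflected onto a multiple of an edge, and maximality selects
    the sign: either the line is perpendicular to an edge [a], with value
    [1 + |b^2 - c^2| / a^2], or it is parallel to an angle bisector, with value
    [max (b / c) (c / b)], where [b] and [c] are the adjacent sides.  The rest is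
    a comparison of these six numbers. *)

(** * Cyclic indices of the vertices *)

Lemma I3P (i j : 'I_3) : [\/ j = i, j = i + 1 | j = i + 2].
Proof.
case: i => [[|[|[|//]]] hi]; case: j => [[|[|[|//]]] hj];
  by [apply: Or31; apply: val_inj | apply: Or32; apply: val_inj
     | apply: Or33; apply: val_inj].
Qed.

Lemma I3_11 (i : 'I_3) : i + 1 + 1 = i + 2.
Proof. by rewrite -addrA. Qed.

Lemma I3_12 (i : 'I_3) : i + 1 + 2 = i.
Proof. by apply: val_inj; case: i => [[|[|[|]]]]. Qed.

Lemma I3_21 (i : 'I_3) : i + 2 + 1 = i.
Proof. by apply: val_inj; case: i => [[|[|[|]]]]. Qed.

Lemma I3_22 (i : 'I_3) : i + 2 + 2 = i + 1.
Proof. by apply: val_inj; case: i => [[|[|[|]]]]. Qed.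

Definition I3E := (I3_11, I3_12, I3_21, I3_22).

(** Starting the sum at an arbitrary [i] lets the later computations be done at a generic vertex. *)
Lemma sumI3 (V : nmodType) (F : 'I_3 -> V) (i : 'I_3) :
  \sum_j F j = F i + F (i + 1) + F (i + 2).
Proof.
rewrite !big_ord_recl big_ord0 addr0.
have -> : lift ord0 ord0 = 1 :> 'I_3 by apply: val_inj.
have -> : lift ord0 (lift ord0 ord0) = 2 :> 'I_3 by apply: val_inj.
have -> : ord0 = 0 :> 'I_3 by apply: val_inj.
case: (I3P i 0) => h.
- by rewrite -h !add0r addrA.
- have -> : i = 2 by rewrite -(addrK 1 i) -h; apply: val_inj.
  have -> : 2 + 1 = 0 :> 'I_3 by apply: val_inj.
  have -> : 2 + 2 = 1 :> 'I_3 by apply: val_inj.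
  by rewrite addrA addrC addrA.
- have -> : i = 1 by rewrite -(addrK 2 i) -h; apply: val_inj.
  have -> : 1 + 1 = 2 :> 'I_3 by apply: val_inj.
  have -> : 1 + 2 = 0 :> 'I_3 by apply: val_inj.
  by rewrite addrC.
Qed.

(** * Linear reflections and the radius function *)

Section Reflection.
Variable R : realType.
Implicit Types (a b c s : R) (x y e w : 'rV[R]_2) (p : 'I_3 -> 'rV[R]_2)
  (i j k m : 'I_3).

Definition vec2 a b : 'rV[R]_2 := \row_j (if j == 0 then a else b).

Lemma vec20 a b : vec2 a b 0 0 = a. Proof. by rewrite mxE. Qed.

Lemma vec21 a b : vec2 a b 0 1 = b. Proof. by rewrite mxE. Qed.

Lemma rV2P x y : x 0 0 = y 0 0 -> x 0 1 = y 0 1 -> x = y.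
Proof.
move=> h0 h1; apply/rowP => j.
case: j => [[|[|//]] hj].
- by have -> : Ordinal hj = 0 by apply: val_inj.
- by have -> : Ordinal hj = 1 by apply: val_inj.
Qed.

Lemma dotE x y : dot x y = x 0 0 * y 0 0 + x 0 1 * y 0 1.
Proof.
rewrite /dot !big_ord_recl big_ord0 addr0.
have -> : lift ord0 ord0 = 1 :> 'I_2 by apply: val_inj.
by have -> : ord0 = 0 :> 'I_2 by apply: val_inj.
Qed.

Definition cross x y : R := x 0 0 * y 0 1 - x 0 1 * y 0 0.

Definition refl c s x : 'rV[R]_2 :=
  vec2 (c * x 0 0 + s * x 0 1) (s * x 0 0 - c * x 0 1).

Lemma addv0 x y (j : 'I_2) : (x + y) 0 j = x 0 j + y 0 j.
Proof. by rewrite mxE. Qed.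
Lemma oppv0 x (j : 'I_2) : (- x) 0 j = - x 0 j.
Proof. by rewrite mxE. Qed.
Lemma scalev0 a x (j : 'I_2) : (a *: x) 0 j = a * x 0 j.
Proof. by rewrite mxE. Qed.
Definition vE := (addv0, oppv0, scalev0, vec20, vec21).

Lemma reflD c s x y : refl c s (x + y) = refl c s x + refl c s y.
Proof. by apply: rV2P; rewrite /refl !vE; ring. Qed.

Lemma reflN c s x : refl c s (- x) = - refl c s x.
Proof. by apply: rV2P; rewrite /refl !vE; ring. Qed.

Lemma reflZ c s a x : refl c s (a *: x) = a *: refl c s x.
Proof. by apply: rV2P; rewrite /refl !vE; ring. Qed.

Lemma reflK c s : c ^+ 2 + s ^+ 2 = 1 -> involutive (refl c s).
Proof.
move=> h x; apply: rV2P; rewrite /refl !vE.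
- transitivity ((c ^+ 2 + s ^+ 2) * x 0 0); first by ring.
  by rewrite h mul1r.
- transitivity ((c ^+ 2 + s ^+ 2) * x 0 1); first by ring.
  by rewrite h mul1r.
Qed.

Lemma cross_refl c s x y : c ^+ 2 + s ^+ 2 = 1 ->
  cross (refl c s x) (refl c s y) = - cross x y.
Proof.
move=> h; transitivity (- (c ^+ 2 + s ^+ 2) * cross x y).
  by rewrite /cross /refl !vE; ring.
by rewrite h mulN1r.
Qed.

Lemma dot_refl c s x y : c ^+ 2 + s ^+ 2 = 1 ->
  dot (refl c s x) (refl c s y) = dot x y.
Proof.
move=> h; transitivity ((c ^+ 2 + s ^+ 2) * dot x y).
  by rewrite !dotE /refl !vE; ring.
by rewrite h mul1r.
Qed.

Lemma dotxx_ge0 x : 0 <= dot x x.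
Proof. by rewrite dotE; nra. Qed.

Lemma dotxx_eq0 x : (dot x x == 0) = (x == 0).
Proof.
apply/eqP/eqP => [|->]; last by rewrite dotE !mxE; ring.
rewrite dotE => h; apply: rV2P; rewrite [RHS]mxE; nra.
Qed.

Lemma dotxx_gt0 x : x != 0 -> 0 < dot x x.
Proof. by move=> h; rewrite lt_def dotxx_eq0 h dotxx_ge0. Qed.

Lemma enorm_ge0 x : 0 <= enorm x. Proof. exact: sqrtr_ge0. Qed.

Lemma enorm_sq x : enorm x ^+ 2 = dot x x.
Proof. by rewrite /enorm sqr_sqrtr ?dotxx_ge0. Qed.

Lemma enorm_gt0 x : x != 0 -> 0 < enorm x.
Proof. by move=> h; rewrite /enorm sqrtr_gt0 dotxx_gt0. Qed.

Lemma enorm_refl c s x : c ^+ 2 + s ^+ 2 = 1 -> enorm (refl c s x) = enorm x.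
Proof. by move=> h; rewrite /enorm dot_refl. Qed.

Lemma enormN x : enorm (- x) = enorm x.
Proof. by rewrite /enorm !dotE !vE !mulrNN. Qed.

Lemma cross_neq0 x y : cross x y != 0 -> x != 0 /\ y != 0.
Proof.
move=> h; split; apply: contraNneq h => ->; rewrite /cross !mxE; apply/eqP; ring.
Qed.

(** By Lagrange's identity the squares of [dot x y] and [enorm x * enorm y] differ by
    [cross x y ^+ 2], so this is the equality case of Cauchy-Schwarz. Multiplying by the norms
    instead of dividing keeps zero vectors included. *)
Lemma cross_eq0_enorm x y : cross x y = 0 ->
  enorm x *: y = enorm y *: x \/ enorm x *: y = - (enorm y *: x).
Proof.
move=> h.
have hx := enorm_ge0 x; have hy := enorm_ge0 y.
have [sx sy] := (enorm_sq x, enorm_sq y).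
have hd : (dot x y - enorm x * enorm y) * (dot x y + enorm x * enorm y) = 0.
  rewrite -subr_sqr exprMn sx sy; transitivity (- cross x y ^+ 2).
    by rewrite !dotE /cross; ring.
  by rewrite h expr0n oppr0.
have key t : t ^+ 2 = 1 -> dot x y = t * (enorm x * enorm y) ->
    enorm x *: y - t *: (enorm y *: x) = 0.
  move=> t2 e; apply/eqP; rewrite -dotxx_eq0; apply/eqP.
  transitivity (enorm x ^+ 2 * dot y y + t ^+ 2 * enorm y ^+ 2 * dot x x
     - 2 * t * enorm x * enorm y * dot x y).
    by rewrite !dotE !vE; ring.
  rewrite e -sx -sy t2.
  transitivity (2 * (1 - t ^+ 2) * (enorm x ^+ 2) * (enorm y ^+ 2)); first ring.
  by rewrite t2; ring.
move/eqP: hd; rewrite mulf_eq0 => /orP [] /eqP e.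
- left; apply/eqP; rewrite -subr_eq0; apply/eqP.
  have := key 1; rewrite scale1r; apply; [ring | lra].
- right; apply/eqP; rewrite -subr_eq0; apply/eqP.
  have := key (-1); rewrite scaleN1r; apply; [ring | lra].
Qed.

(** Twice the signed area: either orientation of the vertices is allowed. *)
Definition area p : R := cross (p 1 - p 0) (p 2 - p 0).

Lemma area_edge p i : cross (edge p i) (p i - p (i + 1)) = area p.
Proof.
rewrite /area; case: (I3P 0 i) => ->; rewrite /edge ?I3E ?add0r /cross !vE; ring.
Qed.

Lemma area_vertex p i : cross (p (i + 1) - p i) (p (i + 2) - p i) = area p.
Proof.
by rewrite -(area_edge p i) /edge /cross !vE; ring.
Qed.

Lemma sum_edge p i : edge p i + edge p (i + 1) + edge p (i + 2) = 0.
Proof. by rewrite /edge !I3E; apply: rV2P; rewrite !vE mxE; ring. Qed.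

Lemma edge_neq0 p i : area p != 0 -> edge p i != 0.
Proof. by rewrite -(area_edge p i) => /cross_neq0 []. Qed.

Lemma edge_length_gt0 p i : area p != 0 -> 0 < edge_length p i.
Proof. by move=> h; apply/enorm_gt0/edge_neq0. Qed.

(** The map sending [x] to [cross (edge p i) x / area p] is the linear part of the [i]-th
    barycentric coordinate. The entry is the opposite of its value at the reflected vertex [j]; with
    this sign a containment bounds the entries of a row from above. *)
Definition entry p c s i j : R := - cross (edge p i) (refl c s (p j)) / area p.

Definition max3 a b c : R := Num.max (Num.max a b) c.

Definition row_max p c s i : R :=
  max3 (entry p c s i 0) (entry p c s i 1) (entry p c s i 2).

Definition refl_radius p c s : R := \sum_i row_max p c s i.

Lemma max3_rot a b c : max3 a b c = max3 b c a.
Proof. by rewrite /max3 -maxA maxC. Qed.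

Lemma row_maxE p c s k i : row_max p c s k =
  max3 (entry p c s k i) (entry p c s k (i + 1)) (entry p c s k (i + 2)).
Proof.
rewrite /row_max; case: (I3P 0 i) => ->; rewrite ?I3E ?add0r //.
- by rewrite max3_rot.
- by rewrite -max3_rot.
Qed.

Lemma max3P a b c : [/\ a <= max3 a b c, b <= max3 a b c, c <= max3 a b c &
  [\/ max3 a b c = a, max3 a b c = b | max3 a b c = c]].
Proof.
rewrite /max3; split; rewrite ?le_max ?lexx ?orbT //.
case: (lerP (Num.max a b) c) => _; first exact: Or33.
by case: (lerP a b) => _; [apply: Or32 | apply: Or31].
Qed.

Lemma max3_sub a b c t : max3 a b c - t = max3 (a - t) (b - t) (c - t).
Proof. by rewrite /max3 !addr_maxl. Qed.

Lemma sum_entry p c s j : \sum_i entry p c s i j = 0.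
Proof.
rewrite (sumI3 _ 0) /entry -!mulrDl.
rewrite [X in X / _](_ : _ = 0) ?mul0r //.
by rewrite /edge ?I3E ?add0r /cross !vE; ring.
Qed.

Lemma entryB p c s i j k :
  entry p c s i j - entry p c s i k = - cross (edge p i) (refl c s (p j - p k)) / area p.
Proof. by rewrite /entry -mulrBl; congr (_ / _); rewrite /cross /refl !vE; ring. Qed.

(** Columns sum to zero, so subtracting column [j] from every row does not change the sum of the
    maxima. Afterwards only reflected differences of vertices occur, and column [j] is zero. *)
Lemma refl_radiusE p c s i j : refl_radius p c s =
  \sum_k max3 (entry p c s k i - entry p c s k j)
    (entry p c s k (i + 1) - entry p c s k j)
    (entry p c s k (i + 2) - entry p c s k j).
Proof.
transitivity (\sum_k (row_max p c s k - entry p c s k j)).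
  by rewrite sumrB sum_entry subr0.
by apply: eq_bigr => k _; rewrite (row_maxE _ _ _ _ i) max3_sub.
Qed.

(** The axis is perpendicular to edge [i], whose direction is reversed. *)
Definition fixes_perp p c s i := refl c s (edge p i) = - edge p i.

(** The axis is parallel to the bisector at [p i]: the unit vector along one side at [p i] is sent
    to the one along the other. Both are multiplied by the lengths to avoid divisions. *)
Definition swaps_rays p c s i :=
  enorm (p (i + 2) - p i) *: refl c s (p (i + 1) - p i) =
  enorm (p (i + 1) - p i) *: (p (i + 2) - p i).

Definition perp_value p i : R := 1 +
  `|edge_length p (i + 1) ^+ 2 - edge_length p (i + 2) ^+ 2| / edge_length p i ^+ 2.

Definition bisector_value p i : R :=
  Num.max (edge_length p (i + 1) / edge_length p (i + 2))
          (edge_length p (i + 2) / edge_length p (i + 1)).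

(** The coordinates of the hypothesis form a linear system in [c] and [s] of determinant [dot e e];
    solving it gives the reflection across the line orthogonal to [e]. *)
Lemma refl_perp c s e w : e != 0 -> refl c s e = - e ->
  refl c s w = w - (2 * dot w e / dot e e) *: e.
Proof.
move=> e0 he.
move: (congr1 (fun z : 'rV[R]_2 => z 0 0) he) (congr1 (fun z : 'rV[R]_2 => z 0 1) he).
rewrite /refl !vE => h0 h1.
have n0 : e 0 0 * e 0 0 + e 0 1 * e 0 1 != 0 by rewrite -dotE dotxx_eq0.
have hc : c = (e 0 1 ^+ 2 - e 0 0 ^+ 2) / (e 0 0 * e 0 0 + e 0 1 * e 0 1).
  apply: (mulIf n0); rewrite divfK //.
  transitivity (e 0 0 * (c * e 0 0 + s * e 0 1) - e 0 1 * (s * e 0 0 - c * e 0 1)).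
    by ring.
  by rewrite h0 h1; ring.
have hs : s = - (2 * e 0 0 * e 0 1) / (e 0 0 * e 0 0 + e 0 1 * e 0 1).
  apply: (mulIf n0); rewrite divfK //.
  transitivity (e 0 1 * (c * e 0 0 + s * e 0 1) + e 0 0 * (s * e 0 0 - c * e 0 1)).
    by ring.
  by rewrite h0 h1; ring.
by apply: rV2P; rewrite !dotE !vE hc hs; field.
Qed.

(** With column [i + 1] subtracted, the rows [i], [i + 1], [i + 2] are [(-1, 0, 0)],
    [(1 - t, 0, -1)] and [(t, 0, 1)]. Their maxima add up to one plus the absolute value of [1 - t],
    and [1 - t] is the difference of the two squared sides over the squared edge. *)
Lemma refl_radius_perp p c s i : area p != 0 -> fixes_perp p c s i ->
  refl_radius p c s = perp_value p i.
Proof.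
rewrite /fixes_perp => hD hp; rewrite (refl_radiusE _ _ _ i (i + 1)) (sumI3 _ i).
rewrite /perp_value /edge_length !enorm_sq.
have he := edge_neq0 i hD.
have n_gt0 := dotxx_gt0 he.
have hD' := hD; rewrite -(area_edge p i) in hD'.
rewrite !entryB -(area_edge p i).
set e := edge p i in hp he n_gt0 hD' *.
set w := p i - p (i + 1) in hD' *.
have -> : edge p (i + 1) = w - e.
  by rewrite /e /w /edge !I3E; apply: rV2P; rewrite !vE; ring.
have -> : edge p (i + 2) = - w.
  by rewrite /e /w /edge !I3E; apply: rV2P; rewrite !vE; ring.
have -> : p (i + 2) - p (i + 1) = e by [].
rewrite subrr -/w.
clearbody e w.
pose t := 2 * dot w e / dot e e.
have hw : refl c s w = w - t *: e := refl_perp w he hp.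
rewrite hp hw.
have -> : refl c s 0 = 0 by apply: rV2P; rewrite /refl !vE !mxE; ring.
have c0 x : - cross x 0 / cross e w = 0 by rewrite /cross !mxE; ring.
rewrite !c0.
have -> : - cross e (w - t *: e) / cross e w = -1.
  by move: hD'; rewrite /cross !vE => hD'; field.
have -> : - cross e (- e) / cross e w = 0 by rewrite /cross !vE; ring.
have -> : - cross (w - e) (w - t *: e) / cross e w = 1 - t.
  by move: hD'; rewrite /cross !vE => hD'; field.
have -> : - cross (w - e) (- e) / cross e w = - 1.
  by move: hD'; rewrite /cross !vE => hD'; field.
have -> : - cross (- w) (w - t *: e) / cross e w = t.
  by move: hD'; rewrite /cross !vE => hD'; field.
have -> : - cross (- w) (- e) / cross e w = 1.
  by move: hD'; rewrite /cross !vE => hD'; field.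
have -> : dot (w - e) (w - e) - dot (- w) (- w) = (1 - t) * dot e e.
  by rewrite /t mulrBl divfK ?lt0r_neq0 // !dotE !vE; ring.
rewrite normrM (ger0_norm (dotxx_ge0 e)) mulfK ?lt0r_neq0 //.
have -> : max3 (-1) (0 : R) 0 = 0 by have [? ? ? [] ?] := max3P (-1) (0 : R) 0; lra.
have [? ? ? [] ?] := max3P (1 - t) 0 (-1); have [? ? ? [] ?] := max3P t 0 1;
  case: (ger0P (1 - t)) => ?; lra.
Qed.

Lemma edge_length1 p i : enorm (p (i + 2) - p i) = edge_length p (i + 1).
Proof. by rewrite /edge_length /edge !I3E -enormN opprB. Qed.

Lemma edge_length2 p i : enorm (p (i + 1) - p i) = edge_length p (i + 2).
Proof. by rewrite /edge_length /edge !I3E. Qed.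

(** With column [i] subtracted and [k] the ratio of the two sides at [p i], the rows are
    [(0, k^-1, k)], [(0, 0, - k)] and [(0, - k^-1, 0)], so only row [i] contributes. *)
Lemma refl_radius_bisector p c s i : c ^+ 2 + s ^+ 2 = 1 -> area p != 0 ->
  swaps_rays p c s i -> refl_radius p c s = bisector_value p i.
Proof.
move=> hcs hD; rewrite /swaps_rays edge_length1 edge_length2 => hb.
rewrite (refl_radiusE _ _ _ i i) (sumI3 _ i) /bisector_value.
have l1 := edge_length_gt0 (i + 1) hD; have l2 := edge_length_gt0 (i + 2) hD.
have hD' := hD; rewrite -(area_vertex p i) in hD'.
rewrite !entryB -(area_vertex p i).
set u := p (i + 1) - p i in hb hD' *.
set v := p (i + 2) - p i in hb hD' *.
have -> : edge p i = v - u.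
  by rewrite /u /v /edge ?I3E; apply: rV2P; rewrite !vE; ring.
have -> : edge p (i + 1) = - v.
  by rewrite /u /v /edge !I3E; apply: rV2P; rewrite !vE; ring.
have -> : edge p (i + 2) = u by rewrite /edge !I3E.
set a := edge_length p (i + 1) in hb l1 *.
set b := edge_length p (i + 2) in hb l2 *.
clearbody u v.
have hu : refl c s u = (b / a) *: v.
  apply: (scalerI (lt0r_neq0 l1)).
  by rewrite hb scalerA mulrC divfK ?lt0r_neq0.
have hv : refl c s v = (a / b) *: u.
  rewrite -[u](reflK hcs) hu reflZ scalerA.
  by rewrite -[a / b]invf_div mulVf ?scale1r // mulf_neq0 ?invr_eq0 // lt0r_neq0.
have ab_gt0 : 0 < a / b by rewrite divr_gt0.
rewrite -[b / a]invf_div.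
set k := a / b in ab_gt0 hv *.
rewrite -[b / a]invf_div -/k in hu.
have k0 : k != 0 := lt0r_neq0 ab_gt0.
rewrite hu hv subrr.
have -> : refl c s 0 = 0 by apply: rV2P; rewrite /refl !vE !mxE; ring.
have c0 x : - cross x 0 / cross u v = 0 by rewrite /cross !mxE; ring.
have ki_gt0 : 0 < k^-1 by rewrite invr_gt0.
rewrite !c0.
have -> : - cross (v - u) (k^-1 *: v) / cross u v = k^-1.
  by move: hD'; rewrite /cross !vE => hD'; field; rewrite ?k0.
have -> : - cross (v - u) (k *: u) / cross u v = k.
  by move: hD'; rewrite /cross !vE => hD'; field; rewrite ?k0.
have -> : - cross (- v) (k^-1 *: v) / cross u v = 0.
  by rewrite /cross !vE; ring.
have -> : - cross (- v) (k *: u) / cross u v = - k.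
  by move: hD'; rewrite /cross !vE => hD'; field; rewrite ?k0.
have -> : - cross u (k^-1 *: v) / cross u v = - k^-1.
  by move: hD'; rewrite /cross !vE => hD'; field; rewrite ?k0.
have -> : - cross u (k *: u) / cross u v = 0 by rewrite /cross !vE; ring.
have -> : max3 0 0 (- k) = 0 by have [? ? ? [] ?] := max3P 0 0 (- k); lra.
have -> : max3 0 (- k^-1) 0 = 0 by have [? ? ? [] ?] := max3P 0 (- k^-1) 0; lra.
have [? ? ? [] ?] := max3P 0 k^-1 k; case: (lerP k k^-1) => ?; lra.
Qed.

End Reflection.

(** * Ties between maximal entries *)

Section Breakpoints.
Variable R : realType.
Implicit Types (a b c s t : R) (x y e w : 'rV[R]_2) (p : 'I_3 -> 'rV[R]_2)
  (i j k m : 'I_3).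

Lemma entry_le_row_max p c s i j : entry p c s i j <= row_max p c s i.
Proof.
by rewrite (row_maxE _ _ _ _ j); have [] := max3P (entry p c s i j)
  (entry p c s i (j + 1)) (entry p c s i (j + 2)).
Qed.

Lemma row_max_le p c s i a : (forall j, entry p c s i j <= a) -> row_max p c s i <= a.
Proof.
move=> h; rewrite /row_max.
by have [_ _ _ [] ->] := max3P (entry p c s i 0) (entry p c s i 1) (entry p c s i 2).
Qed.

Lemma refl_radius_ge0 p c s : 0 <= refl_radius p c s.
Proof. by rewrite -(sum_entry p c s 0) ler_sum // => i _; apply: entry_le_row_max. Qed.

(** The tie makes the reflected edge parallel to the edge itself, hence equal to it up to sign; the
    comparison with column [i] excludes the plus sign. *)
Lemma tie_fixes_perp p c s i : c ^+ 2 + s ^+ 2 = 1 -> area p != 0 ->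
  entry p c s i (i + 1) = entry p c s i (i + 2) ->
  entry p c s i i <= entry p c s i (i + 1) -> fixes_perp p c s i.
Proof.
move=> hcs hD /eqP; rewrite eq_sym -subr_eq0 -subr_le0 !entryB.
rewrite mulf_eq0 invr_eq0 (negPf hD) orbF oppr_eq0 -/(edge p i) => /eqP h0.
have e_gt0 := enorm_gt0 (edge_neq0 i hD).
have := cross_eq0_enorm h0; rewrite enorm_refl // -scalerN => -[] /(scalerI (lt0r_neq0 e_gt0)) // he.
(* If the edge were kept, the entry in column [i] would exceed the tied ones by exactly [1]. *)
by rewrite -{1}he cross_refl // opprK area_edge divff // ler10.
Qed.

(** The tie makes the reflection of one side at [p i] parallel to the other side. A negative
    multiple would put the entry in column [i + 2] strictly above the tied ones. *)
Lemma tie_swaps_rays1 p c s i : c ^+ 2 + s ^+ 2 = 1 -> area p != 0 ->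
  entry p c s (i + 1) (i + 1) = entry p c s (i + 1) i ->
  entry p c s (i + 1) (i + 2) <= entry p c s (i + 1) i -> swaps_rays p c s i.
Proof.
move=> hcs hD /eqP; rewrite -subr_eq0 -subr_le0 !entryB /swaps_rays.
have -> : edge p (i + 1) = - (p (i + 2) - p i).
  by rewrite /edge !I3E opprB.
rewrite mulf_eq0 invr_eq0 (negPf hD) orbF oppr_eq0 -(area_vertex p i).
rewrite -(area_vertex p i) in hD; have [] := cross_neq0 hD.
set u := p (i + 1) - p i in hD *; set v := p (i + 2) - p i in hD *.
have cN x y : cross (- x) y = - cross x y by rewrite /cross !vE; ring.
rewrite !cN oppr_eq0 opprK => /enorm_gt0 u_gt0 /enorm_gt0 v_gt0 /eqP h0.
have := cross_eq0_enorm h0; rewrite enorm_refl // -scalerN => -[] // he.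
have hv : refl c s v = - (enorm v / enorm u) *: u.
  apply: (scalerI (lt0r_neq0 u_gt0)); rewrite scalerA mulrN mulrC divfK ?lt0r_neq0 //.
  rewrite -[in RHS](reflK hcs u) -reflZ scaleNr -reflZ he -reflN; congr (refl _ _ _).
  by rewrite -scalerN opprK.
have -> : cross v (refl c s v) / cross u v = enorm v / enorm u.
  by move: hD; rewrite hv /cross !vE => hD; field; rewrite hD lt0r_neq0.
by rewrite leNgt divr_gt0.
Qed.

(** The same argument with the two sides at [p i] exchanged; since a reflection is an involution,
    the conclusion can be oriented as before. *)
Lemma tie_swaps_rays2 p c s i : c ^+ 2 + s ^+ 2 = 1 -> area p != 0 ->
  entry p c s (i + 2) (i + 2) = entry p c s (i + 2) i ->
  entry p c s (i + 2) (i + 1) <= entry p c s (i + 2) i -> swaps_rays p c s i.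
Proof.
move=> hcs hD /eqP; rewrite -subr_eq0 -subr_le0 !entryB /swaps_rays.
have -> : edge p (i + 2) = p (i + 1) - p i by rewrite /edge !I3E.
rewrite mulf_eq0 invr_eq0 (negPf hD) orbF oppr_eq0 -(area_vertex p i).
rewrite -(area_vertex p i) in hD; have [] := cross_neq0 hD.
set u := p (i + 1) - p i in hD *; set v := p (i + 2) - p i in hD *.
move=> /enorm_gt0 u_gt0 /enorm_gt0 v_gt0 /eqP h0.
have := cross_eq0_enorm h0; rewrite enorm_refl // => -[] he.
  by rewrite -[LHS](reflK hcs) reflZ (reflK hcs) -he reflZ (reflK hcs).
have hu : refl c s u = - (enorm u / enorm v) *: v.
  apply: (scalerI (lt0r_neq0 v_gt0)); rewrite scalerA mulrN mulrC divfK ?lt0r_neq0 //.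
  by rewrite -[LHS](reflK hcs) reflZ (reflK hcs) -[_ *: u]opprK -he reflN reflZ (reflK hcs) scaleNr.
have -> : - cross u (refl c s u) / cross u v = enorm u / enorm v.
  by move: hD; rewrite hu /cross !vE => hD; field; rewrite hD lt0r_neq0.
by rewrite leNgt divr_gt0.
Qed.

(** If the row maxima summed to zero, as each column does, every row would be constant, and its ties
    would force the reflection to reverse every edge. Negating two edges preserves [cross] while a
    reflection changes its sign, so the area would vanish. *)
Lemma refl_radius_gt0 p c s : c ^+ 2 + s ^+ 2 = 1 -> area p != 0 ->
  0 < refl_radius p c s.
Proof.
move=> hcs hD; rewrite lt_def refl_radius_ge0 andbT; apply: contraNneq (hD) => h0.
have eq_entry i j k : entry p c s i j <= entry p c s i k.
  rewrite -subr_ge0 -oppr_le0 -h0 opprB.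
  have /(_ i) : forall l, 0 <= row_max p c s l - entry p c s l k.
    by move=> l; rewrite subr_ge0 entry_le_row_max.
  have : \sum_l (row_max p c s l - entry p c s l k) = 0.
    by rewrite sumrB sum_entry subr0.
  move=> /psumr_eq0P hs _; rewrite h0 -(hs _ i) // ?lerD2r ?entry_le_row_max //.
  by move=> l _; rewrite subr_ge0 entry_le_row_max.
have hp i : fixes_perp p c s i.
  by apply: tie_fixes_perp => //; apply/le_anti; rewrite !eq_entry.
rewrite -(area_edge p 0); have := cross_refl (edge p 0) (edge p 2) hcs.
rewrite !hp => h; suff : cross (edge p 0) (edge p 2) = 0.
  have -> : edge p 2 = p 1 - p 0 by rewrite -[in LHS](add0r 2) /edge !I3E add0r.
  by move=> e0; rewrite add0r -opprB -oppr_eq0 -e0 /cross !vE; apply/eqP; ring.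
by move: h; rewrite /cross !vE; lra.
Qed.

Lemma entry_lin p c s c' s' t i j :
  entry p (c + t * c') (s + t * s') i j = entry p c s i j + t * entry p c' s' i j.
Proof. by rewrite /entry mulrA -mulrDl; congr (_ / _); rewrite /cross /refl !vE; ring. Qed.

Lemma entryZ p c s t i j : entry p (t * c) (t * s) i j = t * entry p c s i j.
Proof. by rewrite /entry mulrA; congr (_ / _); rewrite /cross /refl !vE; ring. Qed.

Lemma refl_radiusZ p c s t : 0 <= t ->
  refl_radius p (t * c) (t * s) = t * refl_radius p c s.
Proof.
move=> t0; rewrite /refl_radius mulr_sumr; apply: eq_bigr => i _.
by rewrite /row_max !entryZ /max3 !maxr_pMr.
Qed.

(** The three kinds of tie cover the three pairs of columns of row [i], so none of them can occur at
    the top of the row. *)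
Lemma strict_row_max p c s i : c ^+ 2 + s ^+ 2 = 1 -> area p != 0 ->
  (forall m, ~ fixes_perp p c s m) -> (forall m, ~ swaps_rays p c s m) ->
  exists k, forall j, j != k -> entry p c s i j < entry p c s i k.
Proof.
move=> hcs hD np ns.
have n1 : ~ (entry p c s i (i + 1) = entry p c s i (i + 2) /\
    entry p c s i i <= entry p c s i (i + 1)).
  by move=> [h1 h2]; apply: (np i); apply: tie_fixes_perp.
have n2 : ~ (entry p c s i i = entry p c s i (i + 2) /\
    entry p c s i (i + 1) <= entry p c s i (i + 2)).
  move=> [h1 h2]; apply: (ns (i + 2)); apply: tie_swaps_rays1 => //; by rewrite !I3E.
have n3 : ~ (entry p c s i i = entry p c s i (i + 1) /\
    entry p c s i (i + 2) <= entry p c s i (i + 1)).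
  move=> [h1 h2]; apply: (ns (i + 1)); apply: tie_swaps_rays2 => //; by rewrite !I3E.
move: n1 n2 n3.
have pick k : (forall j, j = k \/ entry p c s i j < entry p c s i k) ->
    exists k, forall j, j != k -> entry p c s i j < entry p c s i k.
  by move=> h; exists k => j; case: (h j) => [->|//]; rewrite eqxx.
case: (ltgtP (entry p c s i i) (entry p c s i (i + 1))) => h01;
case: (ltgtP (entry p c s i i) (entry p c s i (i + 2))) => h02;
case: (ltgtP (entry p c s i (i + 1)) (entry p c s i (i + 2))) => h12 n1 n2 n3;
  try (by exfalso; lra);
  try (by exfalso; first [apply: n1 | apply: n2 | apply: n3]; split => //; lra);
  [> .. ]; first
  [ by apply: (pick i) => j; case: (I3P i j) => ->; [left | right; lra | right; lra]
  | by apply: (pick (i + 1)) => j; case: (I3P i j) => ->; [right; lra | left | right; lra]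
  | by apply: (pick (i + 2)) => j; case: (I3P i j) => ->; [right; lra | right; lra | left]].
Qed.

(** One of the two tangential directions does not increase the radius. The tangent point lies
    outside the circle, so by homogeneity normalizing divides a positive radius by a number above
    [1]: the decrease is strict even when the slope is zero. *)
Lemma smaller_refl_radius p c s : c ^+ 2 + s ^+ 2 = 1 -> area p != 0 ->
  (forall m, ~ fixes_perp p c s m) -> (forall m, ~ swaps_rays p c s m) ->
  exists c' s', c' ^+ 2 + s' ^+ 2 = 1 /\ refl_radius p c' s' < refl_radius p c s.
Proof.
move=> hcs hD np ns.
have [f hf] := fin_all_exists (fun i => strict_row_max i hcs hD np ns).
(* The rate of change of each entry along the tangent vector [(- s, c)]. *)
pose d i j := entry p (- s) c i j.
have /fin_all_exists [e he] : forall i, exists e : R, 0 < e /\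
    forall j t, `|t| <= e -> t * (d i j - d i (f i)) <= entry p c s i (f i) - entry p c s i j.
  move=> i.
  have : forall j, exists e : R, 0 < e /\ forall t, `|t| <= e ->
     t * (d i j - d i (f i)) <= entry p c s i (f i) - entry p c s i j.
    move=> j; have [->|/hf hj] := eqVneq j (f i).
      by exists 1; split => // t _; rewrite !subrr mulr0.
    pose q := `|d i j - d i (f i)|; have q0 : 0 <= q by rewrite normr_ge0.
    (* The gap to the maximum divided by a bound on the relative slope; the summand [1] covers equal
       slopes. *)
    exists ((entry p c s i (f i) - entry p c s i j) / (1 + q)).
    split; first by rewrite divr_gt0 ?subr_gt0 // ltr_wpDr.
    move=> t; rewrite ler_pdivlMr ?ltr_wpDr // => ht.
    apply: le_trans (ler_norm _) _; rewrite normrM -/q; apply: le_trans ht.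
    by rewrite ler_wpM2l // lerDr.
  move=> /fin_all_exists [e he]; exists (\big[Num.min/1]_j e j); split.
    by apply: (big_ind (fun x : R => 0 < x)) => // [x y x0 y0|j _]; [rewrite lt_min x0 | case: (he j)].
  move=> j t ht; apply: (proj2 (he j) t); apply: le_trans ht _.
  by rewrite (bigD1 j) //= ge_min lexx.
pose E := \big[Num.min/1]_i e i.
have E0 : 0 < E by apply: (big_ind (fun x : R => 0 < x)) => // [x y x0 y0|j _]; [rewrite lt_min x0 | case: (he j)].
have hE t i j : `|t| <= E ->
    entry p (c + t * - s) (s + t * c) i j <= entry p (c + t * - s) (s + t * c) i (f i).
  move=> ht; have := proj2 (he i) j t; rewrite !entry_lin -/(d i j) -/(d i (f i)).
  have -> : `|t| <= e i by apply: le_trans ht _; rewrite /E (bigD1 i) //= ge_min lexx.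
  by move=> /(_ isT); lra.
pose L := \sum_i d i (f i).
(* The step goes against the slope [L], and its size [E] keeps column [f i] maximal in every row
   [i]. *)
pose t := if 0 <= L then - E else E.
have tL : t * L <= 0 by rewrite /t; case: (lerP 0 L) => hL; nra.
have tE : `|t| = E by rewrite /t; case: ifP; rewrite ?normrN gtr0_norm.
have t2 : 0 < t ^+ 2 by rewrite -real_normK ?num_real // tE exprn_gt0.
have F0 := refl_radius_gt0 hcs hD.
have hF : refl_radius p (c + t * - s) (s + t * c) <= refl_radius p c s.
  apply: (@le_trans _ _ (\sum_i (entry p c s i (f i) + t * d i (f i)))).
    apply: ler_sum => i _; apply: row_max_le => j.
    by rewrite /d -entry_lin; apply: hE; rewrite tE.
  rewrite big_split /= -mulr_sumr -/L -[X in _ <= X]addr0 lerD //.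
  by apply: ler_sum => i _; apply: entry_le_row_max.
(* The distance of the tangent point from the origin. *)
pose n := Num.sqrt (1 + t ^+ 2).
have n2 : n ^+ 2 = 1 + t ^+ 2 by rewrite sqr_sqrtr // addr_ge0 // sqr_ge0.
have n1 : 1 < n by have : 0 <= n := sqrtr_ge0 _; nra.
have n0 : 0 < n by lra.
exists (n^-1 * (c + t * - s)), (n^-1 * (s + t * c)); split.
  transitivity ((c ^+ 2 + s ^+ 2) * (1 + t ^+ 2) / n ^+ 2).
    by field; rewrite lt0r_neq0.
  by rewrite hcs mul1r n2 divff // -n2 expf_neq0 // lt0r_neq0.
rewrite refl_radiusZ ?invr_ge0 ?ltW // mulrC ltr_pdivrMr //.
by apply: le_lt_trans hF _; rewrite ltr_pMr.
Qed.

End Breakpoints.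

(** * Reflections across lines *)

Section Lines.
Variable R : realType.
Implicit Types (c s t : R) (a d x y e w : 'rV[R]_2) (p : 'I_3 -> 'rV[R]_2)
  (i j k m : 'I_3) (U K : set 'rV[R]_2).

Definition line a d : set 'rV[R]_2 := [set x | x - a \in <[d]>%VS].

Lemma affine_line a d : d != 0 -> affine_subspace 1 (line a d).
Proof. by move=> d0; exists a, <[d]>%VS; rewrite dim_vline d0. Qed.

Lemma affine_lineP U : affine_subspace 1 U -> exists a d, d != 0 /\ U = line a d.
Proof.
move=> [a [W [W1 ->]]]; exists a, (vpick W).
have W0 : vpick W != 0 by rewrite vpick0 -dimv_eq0 W1.
have eW : W = <[vpick W]>%VS.
  by apply/esym/eqP; rewrite eqEdim dim_vline W0 W1 -memvE memv_pick.
by split=> //; rewrite {1}eW.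
Qed.

Lemma lineP a d x : line a d x <-> exists t, x = a + t *: d.
Proof.
split=> [/vlineP [t h]|[t ->]].
  by exists t; rewrite -h addrC subrK.
by apply/vlineP; exists t; rewrite addrAC subrr add0r.
Qed.

Lemma orth_proj_line a d x : d != 0 ->
  orth_proj (line a d) x = a + (dot (x - a) d / dot d d) *: d.
Proof.
move=> d0; have dd0 : dot d d != 0 by rewrite dotxx_eq0.
apply: get_unique.
  split; first by apply/lineP; exists (dot (x - a) d / dot d d).
  move=> z /lineP [t ->].
  by move: dd0; rewrite !dotE !vE => dd0; field.
(* For uniqueness, orthogonality is tested at the point displaced from [y] by [d]. *)
move=> y [/lineP [t ->] /(_ (a + (t + 1) *: d)) h].
congr (_ + _ *: _); apply: (mulIf dd0); rewrite divfK //.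
apply/eqP; rewrite -subr_eq0; apply/eqP; rewrite -oppr0 -h.
  by rewrite !dotE !vE; ring.
by apply/lineP; exists (t + 1).
Qed.

(** Cosine and, below, sine of twice the angle of [d]. *)
Definition dir_cos d : R := (d 0 0 ^+ 2 - d 0 1 ^+ 2) / dot d d.
Definition dir_sin d : R := (2 * d 0 0 * d 0 1) / dot d d.

Lemma dir_unit d : d != 0 -> dir_cos d ^+ 2 + dir_sin d ^+ 2 = 1.
Proof.
rewrite -dotxx_eq0 /dir_cos /dir_sin dotE => dd0; field.
by rewrite dd0.
Qed.

(** The vector [(1 + c, s)] has half the angle of [(c, s)]. On the circle it vanishes only at
    [c = -1], where the axis is vertical. *)
Lemma unit_dir c s : c ^+ 2 + s ^+ 2 = 1 ->
  exists2 d, d != 0 & c = dir_cos d /\ s = dir_sin d.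
Proof.
move=> h; have [c1|c1] := eqVneq c (-1).
  have s0 : s = 0 by rewrite c1 in h; nra.
  exists (vec2 0 1); last by rewrite /dir_cos /dir_sin dotE !vE c1 s0; split; field.
  by rewrite -dotxx_eq0 dotE !vE mul0r mul1r add0r oner_eq0.
have dd : dot (vec2 (1 + c) s) (vec2 (1 + c) s) = 2 * (1 + c).
  by rewrite dotE !vE -!expr2; have -> : s ^+ 2 = 1 - c ^+ 2; [lra | ring].
have c10 : 1 + c != 0 by rewrite addrC addr_eq0.
exists (vec2 (1 + c) s).
  by rewrite -dotxx_eq0 dd mulf_neq0 // pnatr_eq0.
rewrite /dir_cos /dir_sin dd !vE; split; last by field.
have -> : s ^+ 2 = 1 - c ^+ 2 by lra.
by field.
Qed.

Lemma reflection_line a d x : d != 0 ->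
  reflection (line a d) x = refl (dir_cos d) (dir_sin d) (x - a) + a.
Proof.
move=> d0; rewrite /reflection orth_proj_line //.
have : dot d d != 0 by rewrite dotxx_eq0.
by rewrite /dir_cos /dir_sin => dd0; apply: rV2P; rewrite /refl !vE;
  move: dd0; rewrite !dotE !vE => dd0; field.
Qed.

End Lines.

(** * Barycentric coordinates and the circumradius *)

Section Barycentric.
Variable R : realType.
Implicit Types (c s t : R) (a d x y e w : 'rV[R]_2) (p : 'I_3 -> 'rV[R]_2)
  (i j k m : 'I_3) (U K : set 'rV[R]_2) (v : 'I_3 -> R).

Lemma sum_cross_edge p x : \sum_i cross (edge p i) x / area p = 0.
Proof.
rewrite -mulr_suml (sumI3 _ 0); have := sum_edge p 0.
set e := edge p 0; set e1 := edge _ _; set e2 := edge _ _ => h.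
have -> : cross e x + cross e1 x + cross e2 x = cross (e + e1 + e2) x.
  by rewrite /cross !vE; ring.
by rewrite h /cross !mxE !mul0r subrr mul0r.
Qed.

(** Hence a vector can be found on which the three functionals take any prescribed values of sum
    zero. *)
Lemma cross_edge_comb p v i : area p != 0 -> \sum_j v j = 0 ->
  cross (edge p i) (\sum_j v j *: p j) / area p = v i.
Proof.
move=> hD; rewrite !(sumI3 _ i) => h.
have -> : v i = - v (i + 1) - v (i + 2) by lra.
by move: hD; rewrite -(area_edge p i) /edge /cross !vE => hD; field.
Qed.

Definition bary p i x : R := cross (edge p i) (x - p (i + 1)) / area p.

Lemma sum_bary p x : area p != 0 -> \sum_i bary p i x = 1.
Proof.
move=> hD; rewrite (sumI3 _ 0); move: hD.
by rewrite /bary -(area_edge p 0) /edge !I3E /cross !vE => hD; field.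
Qed.

Lemma bary_comb p x : area p != 0 -> \sum_i bary p i x *: p i = x.
Proof.
move=> hD; rewrite (sumI3 _ 0); move: hD.
rewrite /bary -(area_edge p 0) /edge !I3E /cross !vE => hD.
by apply: rV2P; rewrite !vE; field.
Qed.

Lemma baryE p v i : area p != 0 -> \sum_j v j = 1 ->
  bary p i (\sum_j v j *: p j) = v i.
Proof.
move=> hD; rewrite /bary !(sumI3 _ i) => h.
have -> : v i = 1 - v (i + 1) - v (i + 2) by lra.
by move: hD; rewrite -(area_edge p i) /edge /cross !vE => hD; field.
Qed.

Lemma conv_hullP p x : area p != 0 -> conv_hull p x <-> forall i, 0 <= bary p i x.
Proof.
move=> hD; split=> [[v [v0 v1 ->]] i|h]; first by rewrite baryE.
by exists (bary p ^~ x); rewrite sum_bary // bary_comb.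
Qed.

Lemma vertex_conv_hull p i : conv_hull p (p i).
Proof.
exists (fun j => (j == i)%:R); split=> [j||]; first exact: ler0n.
  by rewrite (bigD1 i) //= big1 ?eqxx ?addr0 // => j /negPf ->.
by rewrite (bigD1 i) //= big1 ?eqxx ?addr0 ?scale1r // => j /negPf ->; rewrite scale0r.
Qed.

(** Finitely many strict inequalities between continuous functions persist near [x]. *)
Lemma interior_conv_hull p x : area p != 0 -> (forall i, 0 < bary p i x) ->
  interior (conv_hull p) x.
Proof.
move=> hD hx; rewrite /interior.
have : \forall y \near x, forall i, 0 < bary p i y.
  apply: (@filter_forall _ _ (fun i y => 0 < bary p i y) (nbhs x) (nbhs_filter x)) => i.
  have cb (F : set_system 'rV[R]_2) (FF : Filter F) :
      y 0 0 @[y --> F] --> x 0 0 -> y 0 1 @[y --> F] --> x 0 1 ->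
      bary p i y @[y --> F] --> bary p i x.
    move=> h0 h1; rewrite /bary /cross.
    have c01 (j : 'I_2) : y 0 j @[y --> F] --> x 0 j ->
        (y - p (i + 1)) 0 j @[y --> F] --> (x - p (i + 1)) 0 j.
      have -> : (fun y => (y - p (i + 1)) 0 j) = (fun y => y 0 j - p (i + 1) 0 j).
        by apply/funext => y; rewrite !vE.
      by rewrite !vE => h; apply: cvgB => //; apply: cvg_cst.
    apply: cvgM; last exact: cvg_cst.
    by apply: cvgB; apply: cvgM; [exact: cvg_cst|exact: c01|exact: cvg_cst|exact: c01].
  apply: cvgr_gt (hx i); apply: cb; exact: coord_continuous.
by apply: filterS => y hy; apply/conv_hullP => // i; apply/ltW.
Qed.

(** The homothet is the set where each [L i] is at least the threshold [Q z i]. The thresholds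
    always add up to [- t], and any three numbers of that sum are the thresholds of some [z].
    Containing the vertices means that each threshold is at most [- row_max p c s i], which can be
    arranged exactly when the row maxima add up to at most [t]. *)
Lemma cover_refl p c s a t : c ^+ 2 + s ^+ 2 = 1 -> area p != 0 -> 0 < t ->
  (exists z, conv_hull p `<=`
     [set z + t *: y | y in [set refl c s (x - a) + a | x in conv_hull p]]) <->
  refl_radius p c s <= t.
Proof.
move=> hcs hD t0.
pose L i x := cross (edge p i) (refl c s x) / area p.
pose Q z i := L i z + t * (L i a - bary p i a).
have LE z x i : L i (z + t *: (refl c s (x - a) + a)) = t * bary p i x + Q z i.
  rewrite /Q /L /bary [refl c s (z + _)]reflD reflZ [refl c s (_ + a)]reflD (reflK hcs) /cross.
  by move: (refl c s z) (refl c s a) => z' a'; rewrite !vE; ring.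
have sumQ z : \sum_i Q z i = - t.
  by rewrite big_split /= -mulr_sumr sumrB !sum_cross_edge sum_bary //; ring.
split=> [[z hz]|ht].
  rewrite -[t]opprK -(sumQ z) -sumrN; apply: ler_sum => i _.
  apply: row_max_le => j.
  have [_ [x hx <-] hj] := hz _ (vertex_conv_hull p j).
  rewrite /entry mulNr lerN2 -/(L i (p j)) -hj LE lerDr.
  by rewrite mulr_ge0 ?(ltW t0) ?(proj1 (conv_hullP x hD) hx).
(* The desired thresholds: the surplus is spread evenly over the three rows to reach the sum
   [- t]. *)
pose r i := - row_max p c s i - (t - refl_radius p c s) / 3.
pose v i := r i - t * (L i a - bary p i a).
have sumv : \sum_i v i = 0.
  rewrite sumrB -mulr_sumr [\sum_i (L _ _ - _)]sumrB sum_cross_edge sum_bary //.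
  rewrite /r sumrB sumrN -/(refl_radius p c s) sumr_const card_ord; lra.
(* The reflection here cancels the one inside [L i], so that [L i z] is [v i]. *)
pose z := refl c s (\sum_j v j *: p j).
have hz i : Q z i = r i.
  by rewrite /Q {1}/L /z (reflK hcs) cross_edge_comb // /v; ring.
exists z => x [u [u0 u1 ->]].
set x0 := \sum_j _.
pose y := t^-1 *: (x0 - z).
have xy : z + t *: y = x0.
  by rewrite /y scalerA divff ?lt0r_neq0 // scale1r addrC subrK.
exists y => //; exists (refl c s (y - a) + a); last by rewrite addrK (reflK hcs) subrK.
apply/conv_hullP => // i; rewrite -(pmulr_rge0 _ t0).
have := LE z (refl c s (y - a) + a) i.
rewrite addrK (reflK hcs) subrK xy hz => h.
rewrite -(lerD2r (r i)) -h add0r.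
have -> : L i x0 = \sum_j u j * - entry p c s i j.
  rewrite /L /x0 /entry !(sumI3 _ i) /cross /refl !vE; ring.
rewrite -[leLHS]mul1r -u1 mulr_suml; apply: ler_sum => j _.
apply: ler_wpM2l => //; rewrite /r.
have := entry_le_row_max p c s i j; lra.
Qed.

(** The base point [a] is absorbed by the translation, so only the direction of the line matters.
    The admissible ratios form a closed half-line with positive left end. *)
Lemma circumradius_reflection p a d : area p != 0 -> d != 0 ->
  circumradius (conv_hull p) (reflection (line a d) @` conv_hull p) =
  refl_radius p (dir_cos d) (dir_sin d).
Proof.
move=> hD d0; have hcs := dir_unit d0; have F0 := refl_radius_gt0 hcs hD.
rewrite /circumradius.
have -> : reflection (line a d) @` conv_hull p =
   [set refl (dir_cos d) (dir_sin d) (x - a) + a | x in conv_hull p].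
  by apply: eq_imagel => x _; rewrite reflection_line.
rewrite [X in inf X](_ : _ = `[refl_radius p (dir_cos d) (dir_sin d), +oo[%classic).
  by rewrite inf_itv.
apply/seteqP; split => t /=; rewrite in_itv /= andbT.
  by move=> [t0 h]; apply/(cover_refl a hcs hD t0).
move=> h; have t0 := lt_le_trans F0 h; split=> //.
exact/(cover_refl a hcs hD t0).
Qed.

End Barycentric.

(** * Inequalities between the sides *)

Section Sides.
Variable R : realType.
Implicit Types (a b c m : R).

Lemma normB_sqr a b : 0 < a -> a <= b -> `|a ^+ 2 - b ^+ 2| = b ^+ 2 - a ^+ 2.
Proof. by move=> a0 ab; rewrite distrC ger0_norm // subr_ge0 ler_pXn2r // nnegrE; lra. Qed.

(** When [a] is strictly between the other sides, the bisector opposite [a] has value [c / b], above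
    the value [c / a] of the bisector opposite the shortest side. *)
Lemma middle_bisector_gt a b c : 0 < b -> b < a -> a < c ->
  Num.max (c / a) (a / c) < Num.max (b / c) (c / b).
Proof.
move=> b0 ba ac; have a0 : 0 < a by lra. have c0 : 0 < c by lra.
rewrite lt_max; apply/orP; right; rewrite gt_max; apply/andP; split.
  by rewrite ltr_pM2l // ltf_pV2 ?posrE.
rewrite ltr_pdivrMr // mulrAC ltr_pdivlMr //; nra.
Qed.

(** Suppose the perpendicular to a side [a] shorter than [b] is optimal. If [c < a], the
    perpendicular to [b] does better. If [a <= c < b], the bisector between [b] and [c] does better,
    because [a ^+ 2 < c * (b + c)]. *)
Lemma perp_minimal a b c : 0 < a -> 0 < c -> a < b -> c <= b ->
  1 + `|b ^+ 2 - c ^+ 2| / a ^+ 2 <= 1 + `|c ^+ 2 - a ^+ 2| / b ^+ 2 ->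
  1 + `|b ^+ 2 - c ^+ 2| / a ^+ 2 <= Num.max (b / c) (c / b) -> a <= c /\ b = c.
Proof.
move=> a0 c0 ab cb; have b0 : 0 < b by lra.
have a2 : 0 < a ^+ 2 by rewrite exprn_gt0.
have b2 : 0 < b ^+ 2 by rewrite exprn_gt0.
have -> : `|b ^+ 2 - c ^+ 2| = b ^+ 2 - c ^+ 2 by rewrite distrC normB_sqr.
rewrite lerD2l ler_pdivrMr // mulrAC ler_pdivlMr // => h1 h2.
have ac : a <= c.
  rewrite leNgt; apply/negP => ca; have ca2 : c ^+ 2 < a ^+ 2 by nra.
  have ab2 : a ^+ 2 < b ^+ 2 by nra.
  move: h1; rewrite (normB_sqr c0 (ltW ca)); apply/negP; rewrite -ltNge.
  by apply: ltr_pM; rewrite ?subr_ge0 ?ltrD2r // ltW.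
split=> //; apply/eqP; rewrite eq_le cb andbT leNgt; apply/negP => cb'.
move: h2; rewrite max_l; last first.
  by rewrite ler_pdivrMr // mulrAC ler_pdivlMr //; nra.
rewrite -lerBrDl; have -> : b / c - 1 = (b - c) / c by field; rewrite lt0r_neq0.
rewrite ler_pdivrMr // mulrAC ler_pdivlMr //; apply/negP; rewrite -ltNge.
rewrite subr_sqr -mulrA ltr_pM2l ?subr_gt0 //; nra.
Qed.

(** For [m > 1], the triangle inequality and [m * b <= a] give [(m - 1) * b < c]. Inserting both
    bounds into the last hypothesis yields [(m - 1) * m ^+ 2 < 1 - (m - 1) ^+ 2], and division by
    [m] leaves [m ^+ 2 < 2]. *)
Lemma values_lt_sqrt2 a b c m : 0 < c -> c <= b -> b <= a -> a < b + c ->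
  m <= b / c -> m <= a / b -> m <= 1 + (b ^+ 2 - c ^+ 2) / a ^+ 2 -> m < Num.sqrt 2.
Proof.
move=> c0 cb ba abc; have [b0 a0] : 0 < b /\ 0 < a by split; lra.
rewrite !ler_pdivlMr // -lerBlDl ler_pdivlMr ?exprn_gt0 // => h1 h2 h3.
case: (lerP m 1) => m1.
  apply: le_lt_trans m1 _; rewrite -[ltLHS]sqrtr1 ltr_sqrt //; lra.
have m0 : 0 < m by lra.
rewrite -(@ltr_pXn2r _ 2) ?nnegrE ?sqrtr_ge0 ?(ltW m0) // sqr_sqrtr //.
have c2 : (b * (m - 1)) ^+ 2 < c ^+ 2 by rewrite ltr_pXn2r ?nnegrE //; nra.
have a2 : (m * b) ^+ 2 <= a ^+ 2 by rewrite ler_pXn2r ?nnegrE //; nra.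
have a2' : (m - 1) * (m * b) ^+ 2 <= (m - 1) * a ^+ 2.
  by rewrite ler_pM2l // subr_gt0.
have h : (m - 1) * m ^+ 2 * b ^+ 2 < (1 - (m - 1) ^+ 2) * b ^+ 2.
  have -> : (m - 1) * m ^+ 2 * b ^+ 2 = (m - 1) * (m * b) ^+ 2 by ring.
  have -> : (1 - (m - 1) ^+ 2) * b ^+ 2 = b ^+ 2 - (b * (m - 1)) ^+ 2 by ring.
  lra.
rewrite ltr_pM2r ?exprn_gt0 // in h.
by rewrite -(ltr_pM2r m0); lra.
Qed.

(** These are the cosines of the angles opposite [a] and [b]; their difference is [a - b] times a
    positive factor. *)
Lemma cosine_le a b c : 0 < a -> 0 < b -> 0 < c -> b <= a -> c < a + b ->
  (b ^+ 2 + c ^+ 2 - a ^+ 2) / (2 * b * c) <= (a ^+ 2 + c ^+ 2 - b ^+ 2) / (2 * a * c).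
Proof.
move=> a0 b0 c0 ba cab.
rewrite -subr_ge0.
have -> : (a ^+ 2 + c ^+ 2 - b ^+ 2) / (2 * a * c) - (b ^+ 2 + c ^+ 2 - a ^+ 2) / (2 * b * c)
   = (a - b) * ((a + b - c) * (a + b + c)) / (2 * a * b * c).
  by field; rewrite !lt0r_neq0.
rewrite divr_ge0 // ?mulr_ge0 ?subr_ge0 //; lra.
Qed.

Lemma acos_le a b : -1 <= a <= 1 -> -1 <= b <= 1 -> a <= b -> acos b <= acos a.
Proof.
move=> ha hb ab; rewrite leNgt; apply/negP => h.
have ia : acos a \in `[0, pi] by rewrite in_itv /= acos_ge0 ?acos_lepi.
have ib : acos b \in `[0, pi] by rewrite in_itv /= acos_ge0 ?acos_lepi.
by move: h; rewrite -ltr_cos // !acosK ?in_itv //= ltNge ab.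
Qed.

End Sides.

(** * Angles, bisectors and existence of a minimizer *)

Section Triangle.
Variable R : realType.
Implicit Types (c s t : R) (a d x y e w : 'rV[R]_2) (p : 'I_3 -> 'rV[R]_2)
  (i j k : 'I_3) (U K : set 'rV[R]_2).

Lemma area_neq0 p : ~ collinear p <-> area p != 0.
Proof.
split=> [nc|hD [U /affine_lineP [a [d [d0 ->]]] hU]].
  apply/negP => /eqP D0; apply: nc.
  (* Either nonzero difference of vertices gives a common direction; if all vertices coincide, any
     vector does. *)
  have [d d0 [t1 [t2 [h1 h2]]]] : exists2 d, d != 0 & exists t1 t2,
      p 1 - p 0 = t1 *: d /\ p 2 - p 0 = t2 *: d.
    have [u0|u0] := eqVneq (p 1 - p 0) 0; last first.
      exists (p 1 - p 0) => //; exists 1; rewrite scale1r.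
      have := cross_eq0_enorm D0; have eu := lt0r_neq0 (enorm_gt0 u0).
      case=> h; [exists (enorm (p 2 - p 0) / enorm (p 1 - p 0))
        |exists (- (enorm (p 2 - p 0) / enorm (p 1 - p 0)))]; split=> //;
        apply: (scalerI eu); rewrite h scalerA; first by rewrite mulrC divfK.
      by rewrite mulrN mulrC divfK // scaleNr.
    have [v0|v0] := eqVneq (p 2 - p 0) 0; last first.
      by exists (p 2 - p 0) => //; exists 0, 1; rewrite u0 scale0r scale1r.
    exists (vec2 1 0); last by exists 0, 0; rewrite u0 v0 scale0r.
    by rewrite -dotxx_eq0 dotE !vE mul0r mul1r addr0 oner_eq0.
  exists (line (p 0) d); first exact: affine_line.
  move=> i; apply/lineP; case: (I3P 0 i) => ->; rewrite ?add0r.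
  - by exists 0; rewrite scale0r addr0.
  - by exists t1; rewrite -h1 addrC subrK.
  - by exists t2; rewrite -h2 addrC subrK.
move/negP: hD; apply; rewrite /area.
have /lineP [t0 ->] := hU 0; have /lineP [t1 ->] := hU 1; have /lineP [t2 ->] := hU 2.
by rewrite /cross !vE; apply/eqP; ring.
Qed.

Lemma law_of_cosines p i : area p != 0 -> interior_angle p i =
  acos ((edge_length p (i + 1) ^+ 2 + edge_length p (i + 2) ^+ 2 - edge_length p i ^+ 2)
     / (2 * edge_length p (i + 1) * edge_length p (i + 2))).
Proof.
move=> hD; rewrite /interior_angle /angle edge_length1 edge_length2; congr acos.
have l1 := edge_length_gt0 (i + 1) hD; have l2 := edge_length_gt0 (i + 2) hD.
have -> : dot (p (i + 1) - p i) (p (i + 2) - p i) =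
  (edge_length p (i + 1) ^+ 2 + edge_length p (i + 2) ^+ 2 - edge_length p i ^+ 2) / 2.
  by rewrite /edge_length !enorm_sq !dotE /edge !I3E !vE; field.
by field; rewrite !lt0r_neq0.
Qed.

(** Heron's formula: the two sides differ by [4 * area p ^+ 2]. *)
Lemma cosine_lt1 p i : area p != 0 ->
  (edge_length p (i + 1) ^+ 2 + edge_length p (i + 2) ^+ 2 - edge_length p i ^+ 2) ^+ 2
     < (2 * edge_length p (i + 1) * edge_length p (i + 2)) ^+ 2.
Proof.
move=> hD; have D2 : 0 < area p ^+ 2 by rewrite -real_normK ?num_real // exprn_gt0 ?normr_gt0.
rewrite !exprMn /edge_length !enorm_sq -subr_gt0.
have e4 : 0 < 4 * area p ^+ 2 by rewrite mulr_gt0.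
apply: (lt_le_trans e4); rewrite -(area_edge p i) le_eqVlt; apply/orP; left; apply/eqP.
by rewrite !dotE /edge /cross !I3E !vE; ring.
Qed.

Lemma triangle_ineq p i : area p != 0 ->
  edge_length p i < edge_length p (i + 1) + edge_length p (i + 2).
Proof.
move=> hD; have := cosine_lt1 i hD.
have := edge_length_gt0 i hD; have := edge_length_gt0 (i + 1) hD.
have := edge_length_gt0 (i + 2) hD.
move: (edge_length p i) (edge_length p (i + 1)) (edge_length p (i + 2)) => a b c c0 b0 a0 h.
rewrite ltNge; apply/negP => h'; move: h; apply/negP; rewrite -leNgt -subr_ge0.
(* In Heron's factorization every factor would be nonnegative if the triangle inequality failed. *)
rewrite [leRHS](_ : _ = (a - b - c) * (a + b + c) * ((a + b - c) * (a + c - b))); last ring.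
by rewrite !mulr_ge0 //; lra.
Qed.

(** Translates the comparisons of sides into the comparisons of angles that the theorem asks for. *)
Lemma interior_angle_le p i j : area p != 0 -> edge_length p j <= edge_length p i ->
  interior_angle p j <= interior_angle p i.
Proof.
move=> hD; rewrite !law_of_cosines //.
have hc k : -1 <= (edge_length p (k + 1) ^+ 2 + edge_length p (k + 2) ^+ 2 -
    edge_length p k ^+ 2) / (2 * edge_length p (k + 1) * edge_length p (k + 2)) <= 1.
  have := cosine_lt1 k hD.
  have l1 := edge_length_gt0 (k + 1) hD; have l2 := edge_length_gt0 (k + 2) hD.
  have l12 : 0 < 2 * edge_length p (k + 1) * edge_length p (k + 2) by rewrite !mulr_gt0.
  move=> h; rewrite -ler_norml normrM normfV (gtr0_norm l12) ler_pdivrMr // mul1r.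
  by rewrite -(@ler_pXn2r _ 2) ?nnegrE // ?(ltW l12) // real_normK ?num_real // ltW.
have l0 := edge_length_gt0 i hD; have l1 := edge_length_gt0 (i + 1) hD.
have l2 := edge_length_gt0 (i + 2) hD.
have t0 := triangle_ineq i hD.
have := triangle_ineq (i + 1) hD; have := triangle_ineq (i + 2) hD; rewrite !I3E => t2 t1 hij.
apply: acos_le => //; move: hij.
case: (I3P i j) => ->; rewrite ?I3E ?lexx // => hij.
- have := cosine_le l0 l1 l2 hij t2.
  congr (_ <= _); congr (_ / _); ring.
- have t1' : edge_length p (i + 1) < edge_length p i + edge_length p (i + 2) by lra.
  have := cosine_le l0 l2 l1 hij t1'.
  congr (_ <= _); congr (_ / _); ring.
Qed.

Lemma parallel_lines a w d : parallel (line a d) (line w d).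
Proof.
exists (w - a); apply/seteqP; split=> x /=.
  move=> /lineP [t ->]; exists (a + t *: d); first by apply/lineP; exists t.
  by rewrite addrA subrK.
move=> [_ /lineP [t ->] <-]; apply/lineP; exists t.
by rewrite addrA subrK.
Qed.

Lemma refl_midline d x : d != 0 ->
  x + refl (dir_cos d) (dir_sin d) x = (2 * dot x d / dot d d) *: d.
Proof.
rewrite -dotxx_eq0 /dir_cos /dir_sin !dotE => d0.
by apply: rV2P; rewrite /refl !vE; field.
Qed.

(** The vector [enorm v *: u + enorm u *: v] is a multiple of [u] plus its reflection, hence lies
    along the axis, and it makes equal angles with [u] and [v]. *)
Lemma swaps_rays_bisector p d i : area p != 0 -> d != 0 ->
  swaps_rays p (dir_cos d) (dir_sin d) i -> angle_bisector p i (line (p i) d).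
Proof.
move=> hD d0; rewrite /swaps_rays.
have [] := @cross_neq0 _ (p (i + 1) - p i) (p (i + 2) - p i); first by rewrite area_vertex.
set u := p (i + 1) - p i; set v := p (i + 2) - p i.
move=> /enorm_gt0 u0 /enorm_gt0 v0 hs; split; first exact: affine_line.
  by apply/lineP; exists 0; rewrite scale0r addr0.
(* Chosen so that the barycentric coordinate at [p i] is one half, which puts the point in the
   interior. *)
pose r := (2 * (enorm u + enorm v))^-1.
have uv0 : 0 < enorm u + enorm v by lra.
have r0 : 0 < r by rewrite invr_gt0 mulr_gt0.
have ruv : r * (enorm u + enorm v) = 2^-1.
  by rewrite /r; field; rewrite lt0r_neq0.
exists (p i + r *: (enorm v *: u + enorm u *: v)); split.
- apply/lineP; exists (r * (enorm v * (2 * dot u d / dot d d))).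
  by rewrite -hs -[in LHS]scalerDr refl_midline // !scalerA mulrA.
- have h1 : 0 < r * enorm u by rewrite mulr_gt0.
  have h2 : 0 < r * enorm v by rewrite mulr_gt0.
  apply: interior_conv_hull => // j.
  have b0 : bary p i (p i + r *: (enorm v *: u + enorm u *: v)) = 1 - r * (enorm u + enorm v).
    move: (hD); rewrite /bary -(area_edge p i) /u /v.
    move: (enorm _) (enorm _) => l1 l2; rewrite /edge /cross !vE => hD'; field.
    by rewrite hD'.
  have b1 : bary p (i + 1) (p i + r *: (enorm v *: u + enorm u *: v)) = r * enorm v.
    move: (hD); rewrite /bary -(area_edge p i) /u /v.
    move: (enorm _) (enorm _) => l1 l2; rewrite /edge !I3E /cross !vE => hD'; field.
    by rewrite hD'.
  have b2 : bary p (i + 2) (p i + r *: (enorm v *: u + enorm u *: v)) = r * enorm u.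
    move: (hD); rewrite /bary -(area_edge p i) /u /v.
    move: (enorm _) (enorm _) => l1 l2; rewrite /edge !I3E /cross !vE => hD'; field.
    by rewrite hD'.
  by case: (I3P i j) => ->; [rewrite b0 ruv; lra | rewrite b1 | rewrite b2].
- rewrite /angle -/u -/v [p i + _]addrC addrK; congr acos.
  set w := r *: _.
  have hw : dot w u * enorm v = dot w v * enorm u.
    transitivity (r * (enorm v * enorm v * dot u u + enorm u * enorm v * dot u v)).
      by rewrite /w !dotE !vE; ring.
    transitivity (r * (enorm u * enorm u * dot v v + enorm u * enorm v * dot u v)).
      by rewrite -!enorm_sq; ring.
    by rewrite /w !dotE !vE; ring.
  have -> : dot w u = dot w v * enorm u / enorm v by rewrite -hw mulfK // lt0r_neq0.
  rewrite !invfM; move: (enorm w)^-1 => n.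
  by field; rewrite !lt0r_neq0.
Qed.

Lemma fixes_perp_perpendicular p a d i : d != 0 ->
  fixes_perp p (dir_cos d) (dir_sin d) i -> perpendicular (line a d) (edge p i).
Proof.
rewrite /fixes_perp => d0 h x y /lineP [t ->] /lineP [t' ->].
have := refl_midline (edge p i) d0; rewrite h subrr => /esym/eqP.
rewrite scaler_eq0 (negPf d0) orbF mulf_eq0 invr_eq0 dotxx_eq0 (negPf d0) orbF.
rewrite mulf_eq0 pnatr_eq0 /= => /eqP h0.
transitivity ((t - t') * dot (edge p i) d); first by rewrite !dotE !vE; ring.
by rewrite h0 mulr0.
Qed.

(** Turns an optimal perpendicular to a shortest base, the only one not to a longest edge, into the
    bisector of a smallest angle. *)
Lemma isosceles_fixes_perp p c s i : area p != 0 ->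
  edge_length p (i + 1) = edge_length p (i + 2) ->
  fixes_perp p c s i -> swaps_rays p c s i.
Proof.
rewrite /swaps_rays edge_length1 edge_length2 => hD el.
move=> /(refl_perp (p (i + 1) - p i) (edge_neq0 i hD)) ->; rewrite el; congr (_ *: _).
have e0 : dot (edge p i) (edge p i) != 0 by rewrite dotxx_eq0 edge_neq0.
have -> : 2 * dot (p (i + 1) - p i) (edge p i) = - dot (edge p i) (edge p i).
  have := congr1 (fun l => l ^+ 2) el; rewrite /edge_length /= !enorm_sq.
  rewrite !dotE /edge !I3E !vE => h; lra.
by rewrite mulNr divff // scaleNr scale1r opprK /edge addrC addrA subrK.
Qed.

Lemma exists_fixes_perp p i : area p != 0 ->
  exists c s, c ^+ 2 + s ^+ 2 = 1 /\ fixes_perp p c s i.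
Proof.
move=> /(edge_neq0 i); rewrite -dotxx_eq0 dotE => e0.
exists ((edge p i 0 1 ^+ 2 - edge p i 0 0 ^+ 2) /
  (edge p i 0 0 * edge p i 0 0 + edge p i 0 1 * edge p i 0 1)).
exists (- (2 * edge p i 0 0 * edge p i 0 1) /
  (edge p i 0 0 * edge p i 0 0 + edge p i 0 1 * edge p i 0 1)).
rewrite /fixes_perp; move: (edge p i) e0 => e e0; split; first by field.
by apply: rV2P; rewrite /refl !vE; field.
Qed.

Lemma exists_swaps_rays p i : area p != 0 ->
  exists c s, c ^+ 2 + s ^+ 2 = 1 /\ swaps_rays p c s i.
Proof.
rewrite -(area_vertex p i) => /cross_neq0; rewrite /swaps_rays.
move: (p (i + 1) - p i) (p (i + 2) - p i) => u v [u0 v0].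
have /lt0r_neq0 eu := enorm_gt0 u0; have /lt0r_neq0 ev := enorm_gt0 v0.
have uu := enorm_sq u; have vv := enorm_sq v; rewrite dotE in uu; rewrite dotE in vv.
(* Cosine and sine of the sum of the angles of [u] and [v]; the axis has half that angle. *)
exists ((u 0 0 * v 0 0 - u 0 1 * v 0 1) / (enorm u * enorm v)).
exists ((u 0 1 * v 0 0 + u 0 0 * v 0 1) / (enorm u * enorm v)).
split.
  transitivity ((u 0 0 * u 0 0 + u 0 1 * u 0 1) * (v 0 0 * v 0 0 + v 0 1 * v 0 1)
    / (enorm u ^+ 2 * enorm v ^+ 2)); first by field; rewrite eu ev.
  by rewrite -uu -vv divff // mulf_neq0 // expf_neq0.
apply: rV2P; rewrite /refl !vE.
- transitivity ((u 0 0 * u 0 0 + u 0 1 * u 0 1) / enorm u * v 0 0).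
    by field; rewrite eu ev.
  by rewrite -uu expr2 mulfK.
- transitivity ((u 0 0 * u 0 0 + u 0 1 * u 0 1) / enorm u * v 0 1).
    by field; rewrite eu ev.
  by rewrite -uu expr2 mulfK.
Qed.

Lemma refl_radius_continuous p : continuous (fun t : R => refl_radius p (cos t) (sin t)).
Proof.
have ce i j : continuous (fun t : R => entry p (cos t) (sin t) i j).
  have -> : (fun t : R => entry p (cos t) (sin t) i j) =
      (fun t => cos t * entry p 1 0 i j + sin t * entry p 0 1 i j).
    apply/funext => t; rewrite -entryZ -entry_lin; congr entry; ring.
  by move=> t; apply: cvgD; (apply: cvgM; last exact: cvg_cst);
    [apply: continuous_cos | apply: continuous_sin].
have cm (f g : R -> R) : continuous f -> continuous g ->
    continuous (fun t => Num.max (f t) (g t)).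
  by move=> hf hg t; apply: (continuous_max (hf t) (hg t)).
have cr i : continuous (fun t : R => row_max p (cos t) (sin t) i).
  by apply: (cm _ _ _ (ce i 2)); apply: (cm _ _ (ce i 0) (ce i 1)).
have -> : (fun t : R => refl_radius p (cos t) (sin t)) =
   (fun t => row_max p (cos t) (sin t) 0 + row_max p (cos t) (sin t) (0 + 1) +
             row_max p (cos t) (sin t) (0 + 2)).
  by apply/funext => t; rewrite /refl_radius (sumI3 _ 0).
by move=> t; apply: cvgD; [apply: cvgD | ]; apply: cr.
Qed.

(** Compactness of the circle, through its parametrization by the angles between [- pi] and [pi]. *)
Lemma exists_min_refl_radius p : exists c s, c ^+ 2 + s ^+ 2 = 1 /\
  forall c' s', c' ^+ 2 + s' ^+ 2 = 1 -> refl_radius p c s <= refl_radius p c' s'.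
Proof.
have pi0 : - pi <= (pi : R) by have := pi_ge0 R; lra.
have [t _ ht] := EVT_min pi0 (continuous_subspaceT (@refl_radius_continuous p)).
exists (cos t), (sin t); split; first exact: cos2Dsin2.
move=> c s hcs.
have hc : -1 <= c <= 1 by apply/andP; split; nra.
have [h0 hpi hcos] : [/\ 0 <= acos c, acos c <= pi & cos (acos c) = c].
  by rewrite acos_ge0 ?acos_lepi ?acosK ?in_itv.
have s2 : 1 - c ^+ 2 = s ^+ 2 by lra.
have := sin_acos hc; rewrite s2 sqrtr_sqr => hsin.
(* The angle of [(c, s)] is [acos c] or its opposite, according to the sign of [s]. *)
case: (lerP 0 s) => s0.
  rewrite ger0_norm // in hsin.
  have := ht (acos c); rewrite hcos hsin; apply; rewrite in_itv /= hpi andbT; lra.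
rewrite ltr0_norm // in hsin.
have := ht (- acos c); rewrite cosN sinN hcos hsin opprK; apply.
by rewrite in_itv /= lerN2 hpi; lra.
Qed.

End Triangle.

(** * The chirality of a triangle *)

Section Chirality.
Variable R : realType.
Implicit Types (c s t : R) (a d x y e w : 'rV[R]_2) (p : 'I_3 -> 'rV[R]_2)
  (i j k : 'I_3) (U K : set 'rV[R]_2).

Lemma chirality_min p c s : area p != 0 -> c ^+ 2 + s ^+ 2 = 1 ->
  (forall c' s', c' ^+ 2 + s' ^+ 2 = 1 -> refl_radius p c s <= refl_radius p c' s') ->
  chirality 1 (conv_hull p) = refl_radius p c s.
Proof.
move=> hD hcs hmin.
have hlb : lbound [set circumradius (conv_hull p) (reflection U @` conv_hull p)
    | U in affine_subspace 1] (refl_radius p c s).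
  move=> _ [U /affine_lineP [a [d [d0 ->]]] <-].
  by rewrite circumradius_reflection //; apply/hmin/dir_unit.
have [d d0 [hc hs]] := unit_dir hcs.
have hin : [set circumradius (conv_hull p) (reflection U @` conv_hull p)
    | U in affine_subspace 1] (refl_radius p c s).
  exists (line 0 d); first exact: affine_line.
  by rewrite circumradius_reflection // -hc -hs.
apply/eqP; rewrite eq_le; apply/andP; split.
  by apply: ge_inf => //; exists (refl_radius p c s).
by apply: lb_le_inf => //; exists (refl_radius p c s).
Qed.

Lemma chirality_le p c s : area p != 0 -> c ^+ 2 + s ^+ 2 = 1 ->
  chirality 1 (conv_hull p) <= refl_radius p c s.
Proof.
move=> hD; have [c0 [s0 [h0 hmin]]] := exists_min_refl_radius p.
by rewrite (chirality_min hD h0 hmin); apply: hmin.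
Qed.

Lemma chirality_attained p : area p != 0 ->
  exists c s, c ^+ 2 + s ^+ 2 = 1 /\ refl_radius p c s = chirality 1 (conv_hull p).
Proof.
move=> hD; have [c0 [s0 [h0 hmin]]] := exists_min_refl_radius p.
by exists c0, s0; rewrite (chirality_min hD h0 hmin).
Qed.

Lemma minimal_direction p c s : area p != 0 -> c ^+ 2 + s ^+ 2 = 1 ->
  refl_radius p c s = chirality 1 (conv_hull p) ->
  exists i, fixes_perp p c s i \/ swaps_rays p c s i.
Proof.
move=> hD hcs hm; apply: contrapT => /forallNP hn.
have [||c' [s' [hcs' /lt_geF]]] := smaller_refl_radius hcs hD.
- by move=> i h; apply: (hn i); left.
- by move=> i h; apply: (hn i); right.
by rewrite hm chirality_le.
Qed.

Lemma chirality_le_perp p i : area p != 0 ->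
  chirality 1 (conv_hull p) <= perp_value p i.
Proof.
move=> hD; have [c [s [hcs h]]] := exists_fixes_perp i hD.
by rewrite -(refl_radius_perp hD h) chirality_le.
Qed.

Lemma chirality_le_bisector p i : area p != 0 ->
  chirality 1 (conv_hull p) <= bisector_value p i.
Proof.
move=> hD; have [c [s [hcs h]]] := exists_swaps_rays i hD.
by rewrite -(refl_radius_bisector hcs hD h) chirality_le.
Qed.

(** All six values are upper bounds; as a minimizer has a special direction, one of them is
    attained. *)
Lemma chirality_value p : area p != 0 -> exists i,
  chirality 1 (conv_hull p) = perp_value p i \/
  chirality 1 (conv_hull p) = bisector_value p i.
Proof.
move=> hD; have [c [s [hcs hm]]] := chirality_attained hD.
have [i [h|h]] := minimal_direction hD hcs hm; exists i; rewrite -hm; [left | right].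
  exact: refl_radius_perp.
exact: refl_radius_bisector.
Qed.

Lemma bisector_value_minimal p i : area p != 0 ->
  bisector_value p i = chirality 1 (conv_hull p) ->
  (forall j, edge_length p j <= edge_length p i) \/
  (forall j, edge_length p i <= edge_length p j).
Proof.
move=> hD hm; have := chirality_le_bisector (i + 1) hD.
have := chirality_le_bisector (i + 2) hD; rewrite -hm /bisector_value !I3E.
have := edge_length_gt0 i hD; have := edge_length_gt0 (i + 1) hD.
have := edge_length_gt0 (i + 2) hD.
have all3 (P : 'I_3 -> Prop) : P i -> P (i + 1) -> P (i + 2) -> forall j, P j.
  by move=> ? ? ? j; case: (I3P i j) => ->.
case: (lerP (edge_length p (i + 1)) (edge_length p i)) => h1;
case: (lerP (edge_length p (i + 2)) (edge_length p i)) => h2 c0 b0 a0 v2 v1.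
- by left; apply: all3.
(* If the two sides agree, edge [i] is a shortest one; otherwise it is strictly intermediate, which
   is excluded. *)
- have [h1'|h1'] := eqVneq (edge_length p (i + 1)) (edge_length p i).
    by right; apply: all3; rewrite ?h1' // ltW.
  have h1'' : edge_length p (i + 1) < edge_length p i by rewrite lt_neqAle h1'.
  by move: v1; rewrite leNgt middle_bisector_gt.
- have [h2'|h2'] := eqVneq (edge_length p (i + 2)) (edge_length p i).
    by right; apply: all3; rewrite ?h2' // ltW.
  have h2'' : edge_length p (i + 2) < edge_length p i by rewrite lt_neqAle h2'.
  move: v2; rewrite leNgt maxC [X in _ < X]maxC; rewrite middle_bisector_gt //.
- by right; apply: all3 => //; apply: ltW.
Qed.

Lemma perp_value_minimal p i : area p != 0 ->
  perp_value p i = chirality 1 (conv_hull p) ->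
  (forall j, edge_length p j <= edge_length p i) \/
  ((forall j, edge_length p i <= edge_length p j) /\
   edge_length p (i + 1) = edge_length p (i + 2)).
Proof.
move=> hD hm; have := chirality_le_bisector i hD.
have := chirality_le_perp (i + 1) hD.
have := chirality_le_perp (i + 2) hD; rewrite -hm /bisector_value /perp_value !I3E.
have := edge_length_gt0 i hD; have := edge_length_gt0 (i + 1) hD.
have := edge_length_gt0 (i + 2) hD.
have all3 (P : 'I_3 -> Prop) : P i -> P (i + 1) -> P (i + 2) -> forall j, P j.
  by move=> ? ? ? j; case: (I3P i j) => ->.
move=> c0 b0 a0 v2 v1 v0.
have [h|h] := boolP ((edge_length p (i + 1) <= edge_length p i) &&
                     (edge_length p (i + 2) <= edge_length p i)).
  by left; case/andP: h => h1 h2; apply: all3.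
right.
case: (lerP (edge_length p (i + 2)) (edge_length p (i + 1))) => h21.
  have ab : edge_length p i < edge_length p (i + 1).
    by rewrite ltNge; apply: contraNN h => h'; rewrite h' (le_trans h21 h').
  have [ac bc] := perp_minimal a0 c0 ab h21 v1 v0.
  by split=> //; apply: all3 => //; apply: ltW.
have ac : edge_length p i < edge_length p (i + 2).
  by rewrite ltNge; apply: contraNN h => h'; rewrite h' (le_trans (ltW h21) h').
(* The same comparison with the sides at [p i] exchanged. *)
rewrite distrC in v2 v0; rewrite [X in _ <= 1 + X / _]distrC in v2; rewrite maxC in v0.
have [ab bc] := perp_minimal a0 b0 ac (ltW h21) v2 v0.
by split=> //; apply: all3 => //; apply: ltW.
Qed.

Lemma minimal_line p a d : area p != 0 -> d != 0 ->
  refl_radius p (dir_cos d) (dir_sin d) = chirality 1 (conv_hull p) ->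
  (exists i B, largest_angle p i /\ angle_bisector p i B /\ parallel (line a d) B) \/
  (exists i B, smallest_angle p i /\ angle_bisector p i B /\ parallel (line a d) B) \/
  (exists i, longest_edge p i /\ perpendicular (line a d) (edge p i)).
Proof.
move=> hD d0 hm; have hcs := dir_unit d0.
have [i [hp|hs]] := minimal_direction hD hcs hm.
  have /(perp_value_minimal hD) := etrans (esym (refl_radius_perp hD hp)) hm.
  case=> [hl|[hl he]].
    by right; right; exists i; split=> //; apply: fixes_perp_perpendicular.
  right; left; exists i, (line (p i) d); split.
    by move=> j; apply: interior_angle_le.
  split; last exact: parallel_lines.
  exact/swaps_rays_bisector/isosceles_fixes_perp.
have /(bisector_value_minimal hD) := etrans (esym (refl_radius_bisector hcs hD hs)) hm.
case=> hl; [left | right; left]; exists i, (line (p i) d); (split; last split);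
  try exact: parallel_lines; try exact: swaps_rays_bisector;
  by move=> j; apply: interior_angle_le.
Qed.

(** * The range of the chirality and the isosceles case *)

Lemma perp_value_ge1 p i : 1 <= perp_value p i.
Proof. by rewrite /perp_value lerDl divr_ge0 // exprn_ge0 // enorm_ge0. Qed.

Lemma bisector_value_ge1 p i : area p != 0 -> 1 <= bisector_value p i.
Proof.
move=> hD; have l1 := edge_length_gt0 (i + 1) hD; have l2 := edge_length_gt0 (i + 2) hD.
rewrite /bisector_value le_max !ler_pdivlMr // !mul1r.
exact: le_total.
Qed.

Lemma chirality_ge1 p : area p != 0 -> 1 <= chirality 1 (conv_hull p).
Proof.
move=> hD; have [i [->|->]] := chirality_value hD.
  exact: perp_value_ge1.
exact: bisector_value_ge1.
Qed.

(** Three of the six values suffice: the perpendicular to a longest edge, the bisector of the angle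
    opposite to it, and the bisector of a smallest angle. *)
Lemma chirality_lt_sqrt2 p : area p != 0 -> chirality 1 (conv_hull p) < Num.sqrt 2.
Proof.
move=> hD.
have [i hi] : exists i, forall j, edge_length p j <= edge_length p i.
  have [i _ hi] := arg_maxP (fun j => edge_length p j) (isT : xpredT (0 : 'I_3)).
  by exists i => j; apply: hi.
have := chirality_le_perp i hD; have := chirality_le_bisector i hD.
have := chirality_le_bisector (i + 1) hD; have := chirality_le_bisector (i + 2) hD.
rewrite /perp_value /bisector_value !I3E.
have a0 := edge_length_gt0 i hD; have b0 := edge_length_gt0 (i + 1) hD.
have c0 := edge_length_gt0 (i + 2) hD.
have t := triangle_ineq i hD; have ba := hi (i + 1); have ca := hi (i + 2).
have mx (u v : R) : 0 < u -> u <= v -> Num.max (u / v) (v / u) = v / u.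
  move=> u0 uv; have v0 : 0 < v by lra.
  by rewrite max_r // ler_pdivrMr // mulrAC ler_pdivlMr //; nra.
case: (lerP (edge_length p (i + 2)) (edge_length p (i + 1))) => h v2 v1 v0 vp.
  apply: (values_lt_sqrt2 c0 h ba t).
  - by rewrite -mx // maxC.
  - by rewrite -mx // maxC.
  - by rewrite -(normB_sqr c0 h) distrC.
apply: (values_lt_sqrt2 b0 (ltW h) ca); first by rewrite addrC.
- by rewrite -mx // ltW.
- by rewrite -mx // maxC.
- by rewrite -(normB_sqr b0 (ltW h)).
Qed.

(** Each of the six values is [1] only if the two sides it compares agree; conversely, the bisector
    at the apex has value [1]. *)
Lemma chirality_eq1 p : area p != 0 -> chirality 1 (conv_hull p) = 1 <-> isosceles p.
Proof.
move=> hD; split=> [|[i [j [ij hij]]]].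
  have [i hi] := chirality_value hD => h1.
  exists (i + 1), (i + 2); split.
    by rewrite (inj_eq (addrI i)).
  have l1 := edge_length_gt0 (i + 1) hD; have l2 := edge_length_gt0 (i + 2) hD.
  move: hi; rewrite h1 => -[|] /eqP.
    rewrite /perp_value -subr_eq0 opprD addrA subrr sub0r oppr_eq0.
    rewrite mulf_eq0 invr_eq0 sqrf_eq0 (gt_eqF (edge_length_gt0 i hD)) orbF.
    by rewrite normr_eq0 subr_eq0 eqrXn2 // ?(ltW l1) ?(ltW l2) // => /eqP.
  rewrite eq_le => /andP [_]; rewrite /bisector_value ge_max !ler_pdivrMr // !mul1r => h.
  by apply/eqP; rewrite eq_le.
apply/eqP; rewrite eq_le chirality_ge1 // andbT.
have [k hk] : exists k, edge_length p (k + 1) = edge_length p (k + 2).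
  case: (I3P i j) ij hij => ->; rewrite ?eqxx // => _ h.
  - by exists (i + 2); rewrite !I3E.
  - by exists (i + 1); rewrite !I3E.
apply: le_trans (chirality_le_bisector k hD) _.
by rewrite /bisector_value hk divff ?maxxx // lt0r_neq0 // edge_length_gt0.
Qed.

(* The sides are [t], [1] and [sqrt q], where [q] is the mean of the bounds
   [(t - 1)^2] (triangle inequality) and [1 - t^2 (t - 1)] (for the value at the
   longest edge to be at least [t]). *)
Lemma triangle_of_chirality t : 1 <= t -> t < Num.sqrt 2 ->
  exists p, area p != 0 /\ chirality 1 (conv_hull p) = t.
Proof.
move=> t1 t2; have t0 : 0 < t by lra.
have tt : t ^+ 2 < 2 by rewrite -[ltRHS](@sqr_sqrtr R) // ltr_pXn2r ?nnegrE ?sqrtr_ge0 // ltW.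
have t3 : t ^+ 3 < 2 * t by rewrite exprS mulrC ltr_pM2r.
pose q : R := (2 * t ^+ 2 - 2 * t + 2 - t ^+ 3) / 2.
have q1 : q <= 1 by rewrite /q; nra.
have qt : (t - 1) ^+ 2 < q by rewrite /q; lra.
have q0 : 0 < q by apply: le_lt_trans qt; apply: sqr_ge0.
have tq : t ^+ 2 * q <= 1 by rewrite /q; nra.
(* By the law of cosines, the abscissa of a point at distance [1] from the origin and [Num.sqrt q]
   from [(t, 0)]. *)
pose x := (t ^+ 2 + 1 - q) / (2 * t).
have x2 : 0 < 1 - x ^+ 2.
  have -> : 1 - x ^+ 2 = (q - (t - 1) ^+ 2) * ((t + 1) ^+ 2 - q) / (2 * t) ^+ 2.
    by rewrite /x; field; rewrite lt0r_neq0.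
  rewrite divr_gt0 ?exprn_gt0 ?mulr_gt0 ?subr_gt0 //; nra.
pose y := Num.sqrt (1 - x ^+ 2).
have y0 : 0 < y by rewrite sqrtr_gt0.
have y2 : y ^+ 2 = 1 - x ^+ 2 by rewrite sqr_sqrtr // ltW.
pose p (i : 'I_3) := if i == 0 then vec2 x y else if i == 1 then vec2 t 0 else 0.
have p0 : p 0 = vec2 x y by [].
have p1 : p 1 = vec2 t 0 by [].
have p2 : p 2 = 0 by [].
clearbody p.
have hD : area p != 0.
  rewrite /area p0 p1 p2 /cross !vE !mxE; apply/eqP => h.
  have : t * y = - 0 by rewrite -h; ring.
  by rewrite oppr0; apply/eqP; rewrite mulf_neq0 // lt0r_neq0.
have l0 : edge_length p 0 = t.
  rewrite /edge_length /edge !add0r p1 p2 /enorm dotE !vE !mxE.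
  by rewrite [X in Num.sqrt X](_ : _ = t ^+ 2) ?sqrtr_sqr ?gtr0_norm //; ring.
have e12 : 1 + 2 = 0 :> 'I_3 by apply: val_inj.
have e11 : 1 + 1 = 2 :> 'I_3 by apply: val_inj.
have e21 : 2 + 1 = 0 :> 'I_3 by apply: val_inj.
have e22 : 2 + 2 = 1 :> 'I_3 by apply: val_inj.
have l1 : edge_length p 1 = 1.
  rewrite /edge_length /edge e11 e12 p0 p2 /enorm dotE !vE !mxE.
  by rewrite [X in Num.sqrt X](_ : _ = 1) ?sqrtr1 //; rewrite !subr0 -!expr2 y2; ring.
have l2 : edge_length p 2 = Num.sqrt q.
  rewrite /edge_length /edge e21 e22 p0 p1 /enorm dotE !vE; congr Num.sqrt.
  transitivity (t ^+ 2 - 2 * t * x + x ^+ 2 + y ^+ 2); first by ring.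
  by rewrite y2 /x; field; rewrite lt0r_neq0.
have r0 : 0 < Num.sqrt q by rewrite sqrtr_gt0.
have r2 : Num.sqrt q ^+ 2 = q by rewrite sqr_sqrtr // ltW.
have r1 : Num.sqrt q <= 1 by rewrite -sqrtr1 ler_sqrt.
have tr : t * Num.sqrt q <= 1.
  by rewrite -(@ler_pXn2r _ 2) ?nnegrE ?mulr_ge0 ?(ltW t0) ?(ltW r0) // exprMn r2 expr1n.
exists p; split=> //; apply/eqP; rewrite eq_le; apply/andP; split.
  (* The sides at vertex [2] have lengths [t] and [1], so this bisector has value [t]. *)
  apply: le_trans (chirality_le_bisector 2 hD) _.
  rewrite /bisector_value e21 e22 l0 l1 divr1 ge_max lexx /= ler_pdivrMr //; nra.
have i3 i : [\/ i = 0, i = 1 | i = 2] by case: (I3P 0 i) => ->; rewrite ?add0r;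
  [apply: Or31 | apply: Or32 | apply: Or33].
(* For the lower bound, each of the six values is checked to be at least [t]. *)
have [i [->|->]] := chirality_value hD; case: (i3 i) => ->;
  rewrite /perp_value /bisector_value ?add0r ?e11 ?e12 ?e21 ?e22 ?l0 ?l1 ?l2 ?r2 -?lerBlDl.
- rewrite ler_pdivlMr ?exprn_gt0 //; apply: le_trans (ler_norm _); rewrite expr1n /q; lra.
- rewrite expr1n divr1 distrC; apply: le_trans (ler_norm _); nra.
- rewrite ler_pdivlMr //; apply: le_trans (ler_norm _); rewrite expr1n; nra.
- by rewrite le_max ler_pdivlMr // tr.
- by rewrite le_max !ler_pdivlMr //; apply/orP; right; nra.
- by rewrite le_max divr1 lexx.
Qed.

End Chirality.

Theorem theorem1p2 (R : realType) :
  (forall (p : 'I_3 -> 'rV[R]_2) (K : set 'rV[R]_2),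
     triangle_with_vertices p K ->
     (exists2 U : set 'rV[R]_2, affine_subspace 1 U &
        circumradius K (reflection U @` K) = chirality 1 K) /\
     (forall U : set 'rV[R]_2, affine_subspace 1 U ->
        circumradius K (reflection U @` K) = chirality 1 K ->
        (exists i B, largest_angle p i /\ angle_bisector p i B /\ parallel U B) \/
        (exists i B, smallest_angle p i /\ angle_bisector p i B /\ parallel U B) \/
        (exists i, longest_edge p i /\ perpendicular U (edge p i)))) /\
  [set chirality 1 K | K in @is_triangle R] = `[1, Num.sqrt 2[%classic /\
  (forall (p : 'I_3 -> 'rV[R]_2) (K : set 'rV[R]_2),
     triangle_with_vertices p K -> (chirality 1 K = 1 <-> isosceles p)).
Proof.
split; [|split].
- move=> p K [/area_neq0 hD ->]; split.
    have [c [s [hcs hm]]] := chirality_attained hD.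
    have [d d0 [hc hs]] := unit_dir hcs.
    exists (line 0 d); first exact: affine_line.
    by rewrite circumradius_reflection // -hc -hs.
  move=> U /affine_lineP [a [d [d0 ->]]]; rewrite circumradius_reflection //.
  exact: minimal_line.
- apply/seteqP; split=> [_ [K [p [/area_neq0 hD ->]] <-]|t] /=; rewrite in_itv /=.
    by rewrite chirality_ge1 // chirality_lt_sqrt2.
  move=> /andP [t1 t2]; have [p [hD <-]] := triangle_of_chirality t1 t2.
  by exists (conv_hull p) => //; exists p; split=> //; apply/area_neq0.
- by move=> p K [/area_neq0 hD ->]; apply: chirality_eq1.
Qed.
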